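(* Consider a pure exploration problem, let $\delta\in(0,1)$, and let $0\le T_{\min}<T_{\max}\le+\infty$. Suppose that a $\delta$-correct batched algorithm satisfies, for some $\gamma,c>0$, $$\mathbb{P}_{\mu}\big(\tau_\delta>\gamma\,T^\star(\mu)\ln(1/\delta)\big)\le c$$ on every Gaussian instance with variance $\sigma^2$ and mean vector $\mu$ such that $T^\star(\mu)\in(T_{\min},T_{\max})$. Let $(\mu^n)_{0\le n\le N}$ be mean vectors of Gaussian instances with variance $\sigma^2$ such that, for some $\zeta\in(0,1)$, $T^\star(\mu^n)=T^\star(\mu^0)\zeta^{-n}\in(T_{\min},T_{\max})$ for all $0\le n\le N$. Then $$\mathbb{P}_{\mu^N}(R_\delta>N)\ \ge\ 1-N(2\delta+c)-\sqrt{\frac{\gamma\ln(1/\delta)}{2(\zeta^{-1}-1)}}\;S_N,$$ where $$S_N=\sum_{n=0}^{N-1}\left[1+\sqrt{\frac{T^\star(\mu^0)}{\zeta^{n}}\ \sup_{w\in\Sigma_K}\sum_{i=1}^K w_i\frac{(\mu_i^{n+1}-\mu_i^n)^2}{2\sigma^2}}\ \right].$$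
   Context: Fix $K\ge1$ arms and $\sigma>0$. $\Sigma_K$ is the probability simplex of $\mathbb{R}^K$. A bandit instance is a vector of $K$ real distributions with mean vector $\mu\in\mathbb{R}^K$; here the arms are Gaussian with variance $\sigma^2$, so an instance is identified with $\mu$, and $\mathbb{P}_\mu$ is the law of the interaction. A pure exploration problem is a set of answers $\mathcal I$ and a non-constant function $i^\star:\mathcal M\to\mathcal I$, where $\mathcal M\subseteq\mathbb{R}^K$ is the set of mean vectors having a unique correct answer; instances have means in $\mathcal M$. $Alt_\mu=\{\lambda\in\mathcal M: i^\star(\lambda)\ne i^\star(\mu)\}$ and $$T^\star(\mu)^{-1}=\sup_{w\in\Sigma_K}\inf_{\lambda\in Alt_\mu}\sum_{i=1}^K w_i\frac{(\mu_i-\lambda_i)^2}{2\sigma^2}.$$ A batched algorithm proceeds in batches (rounds): at the start of a batch, based on all past observations, it chooses how many times to sample each arm in that batch, then observes all those samples (independent draws from the sampled arms); after each batch it either stops and returns an answer $\hat\imath\in\mathcal I$ or starts a new batch. Nothing can be changed or stopped during a batch. $\tau_\delta$ is the total number of samples used when stopping and $R_\delta$ the number of batches used. The algorithm is $\delta$-correct if on every instance the probability of returning an incorrect answer is at most $\delta$ (here, on every Gaussian instance with variance $\sigma^2$). *)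

(* Defs.v *)
From HB Require Import structures.
From mathcomp Require Import all_boot all_order all_algebra finmap.
From mathcomp Require Import all_classical all_reals all_analysis.

Set Implicit Arguments.
Unset Strict Implicit.
Unset Printing Implicit Defensive.

Import Order.TTheory GRing.Theory Num.Theory.
Import numFieldNormedType.Exports.

Local Open Scope classical_set_scope.
Local Open Scope ring_scope.

(* The sigma-algebra on finite sequences is that of the disjoint union of the
   powers T^n: a set of sequences is measurable when, for every n, its trace
   on the sequences of length n is. *)
Section measurable_seq.
Context (d : measure_display) (T : measurableType d).

Definition seq_display : measure_display -> measure_display.
Proof. exact. Qed.

HB.instance Definition _ := isPointed.Build (seq T) [::].

Definition seq_measurable (A : set (seq T)) : Prop :=
  forall n, measurable [set t : n.-tuple T | A (tval t)].

Let seq_measurable0 : seq_measurable set0.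
Proof. by move=> n; exact: measurable0. Qed.

Let seq_measurableC A : seq_measurable A -> seq_measurable (~` A).
Proof. by move=> mA n; exact: (measurableC (mA n)). Qed.

Let seq_measurable_bigcup (F : (set (seq T))^nat) :
  (forall i, seq_measurable (F i)) -> seq_measurable (\bigcup_i F i).
Proof. by move=> mF n; exact: (bigcup_measurable (fun i _ => mF i n)). Qed.

HB.instance Definition _ := @isMeasurable.Build (seq_display d) (seq T)
  seq_measurable seq_measurable0 seq_measurableC seq_measurable_bigcup.
End measurable_seq.

Section complexity.
Context {R : realType} {K : nat}.
Implicit Types mu lambda w : 'rV[R]_K.

Definition simplex : set 'rV[R]_K :=
  [set w | (forall i, 0 <= w 0 i) /\ \sum_i w 0 i = 1].

Definition wdiv (sigma : R) w mu lambda : R :=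
  \sum_i w 0 i * ((mu 0 i - lambda 0 i) ^+ 2 / (2 * sigma ^+ 2)).

Definition alt (I : Type) (M : set 'rV[R]_K) (istar : 'rV[R]_K -> I) mu :
    set 'rV[R]_K :=
  [set lambda | M lambda /\ istar lambda <> istar mu].

(* The inverse is that of \bar R, for which 0^-1 = +oo. *)
Definition Tstar (sigma : R) (I : Type) (M : set 'rV[R]_K)
    (istar : 'rV[R]_K -> I) mu : \bar R :=
  (ereal_sup [set ereal_inf [set (wdiv sigma w mu lambda)%:E
                            | lambda in alt M istar mu]
             | w in simplex])^-1%E.

End complexity.

(* A history is the list of the batches observed so far, oldest first; a batch
   holds, for each arm, the list of the samples drawn from it. *)
Definition batch (R : realType) (K : nat) := K.-tuple (seq R).
Definition history (R : realType) (K : nat) := seq (K.-tuple (seq R)).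

(* S is the space of the private random seed, drawn before the first batch;
   deterministic algorithms are the case S = unit.  Measurability of alloc,
   stop and answer is measurability for the discrete structure on their values
   (for answer, only the events that it takes a given value are constrained). *)
Record batched_algorithm (R : realType) (K : nat) (dS : measure_display)
    (S : measurableType dS) (I : Type) := BatchedAlgorithm {
  alloc : S * history R K -> {ffun 'I_K -> nat} ;
  stop : S * history R K -> bool ;
  answer : S * history R K -> I ;
  measurable_alloc : forall n, measurable [set x | alloc x = n] ;
  measurable_stop : measurable [set x | stop x] ;
  measurable_answer : forall i, measurable [set x | answer x = i] }.

Section run.
Context {R : realType} {K : nat} {dS : measure_display}
  {S : measurableType dS} {I : Type}.
Variable alg : batched_algorithm R K S I.
(* u is the seed, and x r i k is the k-th sample of arm i that batch r would
   produce, batches and samples being numbered from 0. *)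
Variables (u : S) (x : nat -> 'I_K -> nat -> R).

(* The history after r batches, if the algorithm does not stop before. *)
Fixpoint run (r : nat) : history R K :=
  if r is r'.+1 then
    rcons (run r')
      [tuple [seq x r' i k | k <- iota 0 (alloc alg (u, run r') i)] | i < K]
  else [::].

(* The stopping test takes place after each batch, hence never before the
   first one. *)
Definition stops_at (r : nat) : bool := (0 < r)%N && stop alg (u, run r).

(* The number of batches at the first stop, if any. *)
Definition final_batch : option nat :=
  if pselect (exists r, stops_at r) is left stops then Some (ex_minn stops)
  else None.

Definition num_batches : \bar R :=
  if final_batch is Some r then r%:R%:E else +oo%E.

Definition total_samples (h : history R K) : nat :=
  (\sum_(b <- h) \sum_(i < K) size (tnth b i))%N.

Definition num_samples : \bar R :=
  if final_batch is Some r then (total_samples (run r))%:R%:E else +oo%E.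

Definition returned_answer : option I :=
  if final_batch is Some r then Some (answer alg (u, run r)) else None.

End run.

(* Under P, the seed has law nu, the samples of arm i have law
   N(mu_i, sigma^2), and the seed and all the samples are mutually
   independent.  Taking some of the events to be setT, the product rule covers
   all finite subfamilies and the marginal laws. *)
Definition gaussian_bandit (R : realType) (K : nat)
    (dS : measure_display) (S : measurableType dS) (nu : probability S R)
    (dW : measure_display) (W : measurableType dW)
    (U : {mfun W >-> S}) (X : nat -> 'I_K -> nat -> {mfun W >-> R})
    (sigma : R) (mu : 'rV[R]_K) (P : probability W R) : Prop :=
  forall (J : {fset nat * 'I_K * nat}) (A : set S)
      (B : nat * 'I_K * nat -> set R),
    measurable A -> (forall j, measurable (B j)) ->
    P (U @^-1` A `&`
       [set om | forall j, j \in J -> B j (X j.1.1 j.1.2 j.2 om)]) =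
    (nu A * \prod_(j <- J) normal_prob (mu 0%R j.1.2) sigma (B j))%E.

(* Main.v *)
(* Write T_n for T*(mu^n) and a for gamma ln(1/delta), and let A_n be the event
   that the algorithm does not stop within its first n batches and draws at most
   a T_{n-1} = a zeta T_n samples in them; by induction on n, A_n is likely
   under mu^n. Under mu^n, batch n+1 brings the number of samples above a T_n with
   probability at most c only. Whether it does is decided by the first n
   batches, which contain at most a zeta T_n samples, so by Pinsker's inequality
   moving to mu^{n+1} changes the probability by at most the square root of
   a zeta T_n sup_w(...) / 2. Under mu^{n+1}, stopping at batch n+1 after so few
   samples is unlikely: a wrong answer has probability at most delta, and the
   right answer is wrong for some lambda in Alt that a T_n = a zeta T_{n+1}
   samples hardly distinguish from mu^{n+1}, by definition of T_{n+1}.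

   Pinsker's inequality for adaptively chosen samples follows from the
   Donsker-Varadhan inequality E_P ln g <= KL + ln E_Q g: the samples are
   averaged out of g under Q one at a time, the last one first, and an average
   costs the relative entropy of two Gaussians when the sample is used, and
   nothing when it is not. *)
Require Import Defs.
From HB Require Import structures.
From mathcomp Require Import all_boot all_order all_algebra finmap.
From mathcomp Require Import all_classical all_reals all_analysis measurable_realfun.
From mathcomp Require Import ring lra.

Set Implicit Arguments.
Unset Strict Implicit.
Unset Printing Implicit Defensive.

Import Order.TTheory GRing.Theory Num.Theory.
Import numFieldNormedType.Exports.

Local Open Scope classical_set_scope.
Local Open Scope ring_scope.

(** * Gaussian measures and Bernoulli variables *)

Lemma bounded_integrable (R : realType) d (T : measurableType d)
    (P : probability T R)
    (f : T -> R) (M : R) :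
  measurable_fun setT f -> (forall x, `|f x| <= M) ->
  P.-integrable setT (EFin \o f).
Proof.
move=> mf fM; apply: (@le_integrable _ _ _ P _ measurableT _ (cst M%:E)) => //.
- exact/measurable_EFinP.
- by move=> x _ /=; rewrite lee_fin (le_trans (fM x))// ler_norm.
- exact: finite_measure_integrable_cst.
Qed.

Section gaussian.
Context {R : realType}.
Variable sigma : R.
Hypothesis sigma_gt0 : 0 < sigma.
Notation leb := (@lebesgue_measure R).
Notation pdf m := (normal_pdf m sigma).
Implicit Types m l x : R.

Let sigma_neq0 : sigma != 0. Proof. by rewrite gt_eqF. Qed.

Lemma integral_normal_prob m (f : R -> \bar R) :
  (normal_prob m sigma).-integrable setT f ->
  (\int[normal_prob m sigma]_x f x = \int[leb]_x (f x * (pdf m x)%:E))%E.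
Proof.
move=> intf; have mf := measurable_int _ intf.
have dom := @normal_prob_dominates R m sigma.
rewrite -(Radon_Nikodym_change_of_variables dom)//=.
apply: ae_eq_integral => //.
- exact: emeasurable_funM.
- apply: emeasurable_funM => //; apply/measurable_EFinP.
  exact: measurable_normal_pdf.
- apply: ae_eqe_mul2l => /=.
  rewrite Radon_NikodymE//=.
  case: cid => /= h [h1 h2 h3].
  apply: integral_ae_eq => //=.
    by apply/measurableT_comp => //; exact: measurable_normal_pdf.
  by move=> E _ mE; rewrite -h3.
Qed.

Lemma normal_pdf_shift m h x :
  pdf (m + h) x =
  pdf m x * expR (h * (x - m) / sigma ^+ 2 - h ^+ 2 / (2 * sigma ^+ 2)).
Proof.
rewrite !normal_pdfE//= /normal_fun -[RHS]mulrA -expRD; congr (_ * expR _).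
by rewrite -mulr_natr; field.
Qed.

(** With w = (x - m) / sigma^2, the domination comes from |w| <= e^w + e^-w: by [normal_pdf_shift],
    e^w and e^-w times [pdf m] are constant multiples of the densities with means m + 1 and m -
    1. *)
Lemma integrable_center_normal_pdf m :
  leb.-integrable setT (fun x => ((x - m) * pdf m x)%:E).
Proof.
pose c := expR (1 / (2 * sigma ^+ 2)) * sigma ^+ 2.
have intp := integrable_normal_pdf.
apply: (@le_integrable _ _ _ leb _ measurableT _
  (fun x => (c * (pdf (m + 1) x + pdf (m - 1) x))%:E)).
- apply/measurable_EFinP; apply: measurable_funM; first exact: measurable_funB.
  exact: measurable_normal_pdf.
- move=> x _; rewrite /= lee_fin !normal_pdf_shift.
  have p0 := normal_pdf_ge0 m sigma x.
  rewrite normrM (ger0_norm p0) -mulrDr sqrrN expr1n.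
  rewrite mulrCA [leRHS]ger0_norm; last first.
    by rewrite mulr_ge0// mulr_ge0 ?addr_ge0 ?expR_ge0// mulr_ge0 ?expR_ge0 ?sqr_ge0.
  rewrite mulrC ler_wpM2l// mul1r mulN1r !expRD -mulrDl expRN /c div1r mulNr.
  have s20 : 0 < sigma ^+ 2 by rewrite exprn_gt0.
  have e0 : expR (2 * sigma ^+ 2)^-1 != 0 by rewrite gt_eqF ?expR_gt0.
  set w := (x - m) / _; have -> : x - m = w * sigma ^+ 2 by rewrite divfK// gt_eqF.
  set e := expR (2 * _)^-1 in e0 *.
  rewrite [leRHS](_ : _ = (expR w + expR (- w)) * sigma ^+ 2); last by field.
  rewrite normrM (gtr0_norm s20) (ler_wpM2r (ltW s20))//.
  have := expR_ge1Dx w; have := expR_ge1Dx (- w).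
  have := expR_gt0 w; have := expR_gt0 (- w).
  by rewrite ler_norml => ? ? ? ?; lra.
- have := integrableZl measurableT c
    (integrableD measurableT (intp R (m + 1) sigma) (intp R (m - 1) sigma)).
  by apply: eq_integrable => // x _ /=; rewrite EFinM EFinD.
Qed.

(* Integrating [pdf (m + h) x >= pdf m x * (1 + log ratio)] for the two signs
   of [h] forces the first central moment to vanish. *)
Lemma integral_center_normal_pdf m :
  (\int[leb]_x ((x - m) * pdf m x)%:E = 0)%E.
Proof.
have intc := integrable_center_normal_pdf m.
have intp := integrable_normal_pdf.
have fin : (\int[leb]_x ((x - m) * pdf m x)%:E)%E \is a fin_num.
  exact: integrable_fin_num.
rewrite -(fineK fin); set e := fine _; congr (_%:E).
have s20 : 0 < sigma ^+ 2 by rewrite exprn_gt0.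
have key h : h * e <= h ^+ 2 / 2.
  pose a := 1 - h ^+ 2 / (2 * sigma ^+ 2).
  have : (\int[leb]_x (a%:E * (pdf m x)%:E +
        (h / sigma ^+ 2)%:E * ((x - m) * pdf m x)%:E)
      <= \int[leb]_x (pdf (m + h) x)%:E)%E.
    apply: le_integral => //.
    - by apply: integrableD => //; exact: integrableZl.
    - move=> x _; rewrite -!EFinM -EFinD lee_fin normal_pdf_shift.
      have := expR_ge1Dx (h * (x - m) / sigma ^+ 2 - h ^+ 2 / (2 * sigma ^+ 2)).
      move=> /(ler_wpM2l (normal_pdf_ge0 m sigma x)); apply: le_trans.
      by rewrite /a le_eqVlt; apply/orP; left; apply/eqP; ring.
  rewrite integral_normal_pdf integralD//; [|exact: integrableZl..].
  rewrite !integralZl// integral_normal_pdf -(fineK fin) -/e.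
  rewrite -!EFinM -EFinD lee_fin /a mulr1 => H.
  have : h * e / sigma ^+ 2 <= h ^+ 2 / 2 / sigma ^+ 2.
    rewrite -subr_ge0 in H; rewrite -subr_ge0 (le_trans H)// le_eqVlt.
    by apply/orP; left; apply/eqP; field.
  by rewrite ler_pM2r// invr_gt0.
(* At h = e the bound reads e^2 <= e^2 / 2. *)
have := key e; have := key (- e).
by move=> H1 H2; apply/eqP; rewrite -sqrf_eq0 eq_le sqr_ge0 andbT; lra.
Qed.

(* Donsker-Varadhan for two Gaussians, the relative entropy being computed. *)
Lemma normal_ln_le m l (g : R -> R) (b : R) :
  measurable_fun setT g -> (forall x, 1 <= g x <= b) ->
  (\int[normal_prob m sigma]_x (ln (g x))%:E <=
   (ln (fine (\int[normal_prob l sigma]_x (g x)%:E))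
     + (m - l) ^+ 2 / (2 * sigma ^+ 2))%:E)%E.
Proof.
move=> mg gb.
have g0 x : 0 < g x by have /andP[+ _] := gb x; apply: lt_le_trans.
have lngb x : `|ln (g x)| <= ln b.
  have /andP[g1 gxb] := gb x.
  by rewrite ger0_norm ?ln_ge0// ler_ln ?posrE// (lt_le_trans _ gxb).
have mlng : measurable_fun setT (fun x => ln (g x)) by exact: measurableT_comp.
have intl : (normal_prob m sigma).-integrable setT (EFin \o (fun x => ln (g x))).
  exact: (@bounded_integrable _ _ _ (normal_prob m sigma) _ (ln b)).
have intg : (normal_prob l sigma).-integrable setT (EFin \o g).
  apply: (@bounded_integrable _ _ _ (normal_prob l sigma) _ b) => // x.
  by rewrite gtr0_norm//; have /andP[] := gb x.
rewrite integral_normal_prob// integral_normal_prob//=.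
have intp := integrable_normal_pdf.
have intlp : leb.-integrable setT (fun x => (ln (g x) * pdf m x)%:E).
  apply: (@le_integrable _ _ _ leb _ measurableT _
    (fun x => ((ln b)%:E * (pdf m x)%:E)%E)).
  - apply/measurable_EFinP; apply: measurable_funM => //.
    exact: measurable_normal_pdf.
  - move=> x _ /=; rewrite lee_fin !normrM ler_wpM2r ?normr_ge0//.
    by rewrite (le_trans (lngb x))// ler_norm.
  - exact: integrableZl.
have intgp : leb.-integrable setT (fun x => (g x * pdf l x)%:E).
  apply: (@le_integrable _ _ _ leb _ measurableT _
    (fun x => (b%:E * (pdf l x)%:E)%E)).
  - apply/measurable_EFinP; apply: measurable_funM => //.
    exact: measurable_normal_pdf.
  - move=> x _ /=; have /andP[_ gxb] := gb x.
    rewrite lee_fin ger0_norm ?mulr_ge0 ?normal_pdf_ge0//; last exact: ltW.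
    by rewrite (le_trans _ (ler_norm _))// ler_wpM2r ?normal_pdf_ge0.
  - exact: integrableZl.
under eq_integral do rewrite -EFinM.
under [in leRHS]eq_integral do rewrite -EFinM.
have finl : (\int[leb]_x (ln (g x) * pdf m x)%:E)%E \is a fin_num.
  exact: integrable_fin_num.
have fing : (\int[leb]_x (g x * pdf l x)%:E)%E \is a fin_num.
  exact: integrable_fin_num.
rewrite -(fineK finl) lee_fin.
set c0 := fine _; set k := _ / _; set A := fine _.
pose s := (l - m) / sigma ^+ 2.
pose a := c0 - k.
suff aA : expR a <= A.
  have A0 : 0 < A by rewrite (lt_le_trans _ aA)// expR_gt0.
  by rewrite -lerBlDr -/a -[leLHS]expRK ler_ln ?posrE ?expR_gt0.
have intc := integrable_center_normal_pdf m.
(* Write g times [pdf l] as [pdf m] times expR y, with y = ln g + s (x - m) - k. Then [h] replaces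
   expR y by its tangent at a, the mean of y under [normal_prob m sigma], so that only expR a is
   left after integration. *)
pose h x := ((expR a)%:E * ((1 - a - k)%:E * (pdf m x)%:E
  + (ln (g x) * pdf m x)%:E + s%:E * ((x - m) * pdf m x)%:E))%E.
have inth1 : leb.-integrable setT (fun x => ((1 - a - k)%:E * (pdf m x)%:E
    + (ln (g x) * pdf m x)%:E)%E).
  by apply: integrableD => //; exact: integrableZl.
have inth2 : leb.-integrable setT (fun x => ((1 - a - k)%:E * (pdf m x)%:E
    + (ln (g x) * pdf m x)%:E + s%:E * ((x - m) * pdf m x)%:E)%E).
  by apply: integrableD => //; exact: integrableZl.
have hE : (\int[leb]_x h x = (expR a)%:E)%E.
  rewrite integralZl// integralD//; last exact: integrableZl.
  rewrite integralD//; last exact: integrableZl.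
  rewrite !integralZl// integral_normal_pdf integral_center_normal_pdf.
  rewrite -(fineK finl) -/c0 mule0 adde0 mule1 -EFinD -EFinM.
  by rewrite (_ : 1 - a - k + c0 = 1) ?mulr1// /a; ring.
rewrite -lee_fin (fineK fing) -hE.
apply: le_integral => //; first exact: integrableZl.
move=> x _; rewrite /h -!(EFinM, EFinD) lee_fin.
have -> : pdf l x = pdf m x * expR (s * (x - m) - k).
  rewrite -[in LHS](subrKC m l) normal_pdf_shift; congr (_ * expR _).
  by rewrite /s /k; field.
rewrite -[X in _ <= X * _]lnK ?posrE//.
rewrite [leRHS]mulrCA -expRD.
have := expR_ge1Dx (ln (g x) + (s * (x - m) - k) - a).
move=> /(ler_wpM2l (expR_ge0 a)); rewrite -expRD.
rewrite subrKC.
move=> /(ler_wpM2l (normal_pdf_ge0 m sigma x)); apply: le_trans.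
by rewrite le_eqVlt; apply/orP; left; apply/eqP; ring.
Qed.

End gaussian.

(* Hoeffding's lemma for a Bernoulli variable. *)
Lemma ln_bernoulli_le (R : realType) (q s : R) : 0 <= q <= 1 -> 0 <= s ->
  ln (1 - q + q * expR s) <= q * s + s ^+ 2 / 8.
Proof.
move=> /andP[q0 q1] s0.
pose D : R -> R := fun x => 1 - q + q * expR x.
have D0 x : 0 < D x.
  rewrite /D; have := expR_gt0 x => e0.
  have [->|q'] := eqVneq q 0; first by rewrite mul0r addr0 subr0.
  by rewrite ltr_wpDl ?subr_ge0// mulr_gt0// lt0r q'.
have dD (x : R) : is_derive x 1 D (q * expR x).
  rewrite /D; apply: is_derive_eq.
  by rewrite add0r mul1r.
(* [f1] is the derivative of [f2] below; both vanish at 0, and the derivative of [f1] is 1/4 - y (1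
   - y) >= 0 for y = q * expR x / D x. *)
pose f1 : R -> R := fun x => q + x / 4 - q * expR x / D x.
have df1 (x : R) : is_derive x 1 f1
    (4^-1 - (q * expR x / D x) * (1 - q * expR x / D x)).
  have D' : is_derive x 1 (fun y => (D y)^-1) (- (D x) ^- 2 *: (q * expR x)).
    by apply: is_deriveV => //; rewrite gt_eqF.
  rewrite /f1; apply: is_derive_eq.
  have Dx : D x != 0 by rewrite gt_eqF.
  by rewrite /GRing.scale/=; field; rewrite Dx.
pose f2 : R -> R := fun x => q * x + x ^+ 2 / 8 - ln (D x).
have df2 (x : R) : is_derive x 1 f2 (f1 x).
  have D' : is_derive x 1 ((@ln R) \o D) ((D x)^-1 * (q * expR x)).
    by apply: is_derive1_comp; exact: is_derive1_ln.
  rewrite /f2; apply: is_derive_eq.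
  by rewrite /f1 /GRing.scale/=; field; rewrite gt_eqF.
have mvt (f df : R -> R) : (forall x : R, is_derive x 1 f (df x)) -> f 0 = 0 ->
    (forall x : R, 0 <= x -> 0 <= df x) -> forall x : R, 0 <= x -> 0 <= f x.
  move=> fdf f00 df0 x x0.
  have cf : {within `[0, x], continuous f}.
    by apply: derivable_within_continuous => y _; have [] := fdf y.
  have [c] := MVT_segment x0 (fun y _ => fdf y) cf.
  rewrite in_itv/= => /andP[c0 _]; rewrite f00 !subr0 => ->.
  by rewrite mulr_ge0// df0.
have D00 : D 0 = 1 by rewrite /D expR0 mulr1 subrK.
have : 0 <= f2 s.
  apply: (mvt f2 f1) => //; first by rewrite /f2 D00 ln1; ring.
  apply: (mvt f1 _ df1); first by rewrite /f1 D00 expR0; field.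
  move=> x _; set y := q * _ / _.
  by have := sqr_ge0 (y - 2^-1); rewrite sqrrB -subr_ge0 => ?; lra.
by rewrite /f2 subr_ge0.
Qed.

(** * Relative entropy of adaptively used samples *)

Section resampling.
Context {R : realType} {dS : measure_display} {S : measurableType dS}.
Variables (nu : probability S R) (sigma : R) (m : nat).
Notation T := (S * m.-tuple R)%type.
Implicit Types (theta : 'I_m -> R) (j : 'I_m) (t : T).

Definition rectangle (A : set S) (B : 'I_m -> set R) : set T :=
  A `*` [set v | forall j, B j (tnth v j)].

Definition sample_law theta (Q : probability T R) : Prop :=
  forall A B, measurable A -> (forall j, measurable (B j)) ->
  Q (rectangle A B) = (nu A * \prod_j normal_prob (theta j) sigma (B j))%E.

Definition update t j (y : R) : T :=
  (t.1, [tuple if i == j then y else tnth t.2 i | i < m]).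

Lemma tnth_update t j y i :
  tnth (update t j y).2 i = if i == j then y else tnth t.2 i.
Proof. exact: tnth_mktuple. Qed.

Lemma measurable_update j :
  measurable_fun setT (fun x : T * R => update x.1 j x.2).
Proof.
apply: measurable_fun_pair => /=; first exact: measurableT_comp.
apply/measurable_fun_tnthP => i.
rewrite (_ : _ \o _ = fun x : T * R => if i == j then x.2 else tnth x.1.2 i).
  case: (i == j); first exact: measurable_snd.
  apply: (@measurableT_comp _ _ _ _ _ _ (fun v : m.-tuple R => tnth v i)).
    exact: measurable_tnth.
  exact: measurableT_comp.
by apply/funext => x; rewrite /= tnth_mktuple.
Qed.

Let rects : set (set T) := [set E | exists A B, [/\ measurable A,
  forall j, measurable (B j) & E = rectangle A B]].

Lemma measurable_rectangle A B :
  measurable A -> (forall j, measurable (B j)) -> measurable (rectangle A B).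
Proof.
move=> mA mB; apply: measurableX => //.
rewrite (_ : [set _ | _] = \bigcap_(j in [set: 'I_m]) ((@tnth m R)^~ j @^-1` B j)).
  apply: fin_bigcap_measurable => //.
  by move=> j _; rewrite -[X in measurable X]setTI; exact: measurable_tnth.
by apply/seteqP; split => v /= Bv j; [move=> _|]; exact: Bv.
Qed.

Let rectsE : @measurable _ T = <<s rects >>.
Proof.
apply/seteqP; split; last first.
  apply: smallest_sub; first exact: sigma_algebra_measurable.
  by move=> _ [A [B [mA mB ->]]]; exact: measurable_rectangle.
(* The identity is measurable from the sigma-algebra generated by the rectangles because each
   coordinate is: its preimages are rectangles with a single constrained side. *)
have mid : measurable_fun (setT : set (g_sigma_algebraType rects)) (id : _ -> T).
  apply/measurable_fun_pairP; split.
    move=> _ A mA; rewrite setTI; apply: sub_sigma_algebra.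
    exists A, (fun=> setT); split => //.
    by apply/seteqP; split => x /=; [|case].
  apply/measurable_fun_tnthP => j _ B mB; rewrite setTI.
  apply: sub_sigma_algebra.
  exists setT, (fun i => if i == j then B else setT); split => //.
    by move=> i; case: ifP.
  apply/seteqP; split => x /= => [Bx|[_ /(_ j)]]; last by rewrite eqxx.
  by split => // i; case: eqP => // ->.
by move=> E mE; have := mid measurableT E mE; rewrite setTI.
Qed.

Lemma rectangle_measure_unique (Q1 : probability T R)
    (Q2 : {measure set T -> \bar R}) :
  (forall A B, measurable A -> (forall j, measurable (B j)) ->
    Q1 (rectangle A B) = Q2 (rectangle A B)) ->
  forall E, measurable E -> Q1 E = Q2 E.
Proof.
move=> Q12; apply: (measure_unique rects (fun=> setT) rectsE).
- move=> _ _ [A [B [mA mB ->]]] [A' [B' [mA' mB' ->]]].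
  exists (A `&` A'), (fun j => B j `&` B' j); split.
  + exact: measurableI.
  + by move=> j; exact: measurableI.
  + apply/seteqP; split => [x [[? Bx] [? Bx']]|x [[? ?] Bx]]; split => //.
    by split => //= j; have [] := Bx j.
    by split => //= j; have [] := Bx j.
- move=> _; exists setT, (fun=> setT); split => //.
  by apply/seteqP; split.
- by rewrite bigcup_const.
- by move=> _ [A [B [mA mB ->]]]; exact: Q12.
- by move=> _; rewrite (le_lt_trans (probability_le1 Q1 measurableT)) ?ltry.
Qed.

(** Replacing one sample by an independent fresh copy preserves [Q], since both laws agree on
    rectangles. Fubini-Tonelli then isolates the fresh copy. *)
Lemma integral_resample theta Q (f : T -> \bar R) j : sample_law theta Q ->
  measurable_fun setT f -> (forall t, 0 <= f t)%E ->
  (\int[Q]_t f t =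
   \int[Q]_t \int[normal_prob (theta j) sigma]_y f (update t j y))%E.
Proof.
move=> lawQ mf f0.
pose N := normal_prob (theta j) sigma.
pose phi (x : T * measurableTypeR R) := update x.1 j x.2.
have mphi : measurable_fun setT phi by exact: measurable_update.
pose phi_mixin := isMeasurableFun.Build _ _ _ _ phi mphi.
pose Phi : {mfun (T * measurableTypeR R)%type >-> T%type} := HB.pack phi phi_mixin.
transitivity (\int[pushforward (Q \x N) Phi]_t f t)%E.
  apply: eq_measure_integral => E mE _.
  apply: rectangle_measure_unique => // A B mA mB.
  pose B' i := if i == j then setT else B i.
  have mB' i : measurable (B' i) by rewrite /B'; case: ifP.
  have phiE : phi @^-1` rectangle A B = rectangle A B' `*` B j.
    apply/seteqP; split => [[t y] /= [At Bt]|[t y] /= [[At Bt] By]].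
      split; first split => // i.
        rewrite /B'; case: eqP => // /eqP ij.
        by have := Bt i; rewrite tnth_mktuple (negbTE ij).
      by have := Bt j; rewrite tnth_mktuple eqxx.
    split => // i; rewrite tnth_mktuple; case: eqP => [->//|/eqP ij].
    by have := Bt i; rewrite /B' (negbTE ij).
  have mr : measurable (rectangle A B') := measurable_rectangle mA mB'.
  transitivity (Q (rectangle A B') * normal_prob (theta j) sigma (B j))%E.
    rewrite (lawQ _ _ mA mB) (lawQ _ _ mA mB') -[RHS]muleA; congr (_ * _)%E.
    rewrite (bigD1 j)//= [in RHS](bigD1 j)//= {1}/B' eqxx probability_setT mul1e.
    rewrite muleC; congr (_ * _)%E; apply: eq_bigr => i ij.
    by rewrite /B' (negbTE ij).
  transitivity ((Q \x N) (rectangle A B' `*` B j))%E; last by rewrite -phiE.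
  by apply/esym/product_measure1E => //; exact: (mB j).
rewrite ge0_integral_pushforward//= preimage_setT.
have mfphi : measurable_fun setT (f \o phi) by exact: measurableT_comp.
exact: (@fubini_tonelli1 _ _ _ _ R Q N (f \o phi) mfphi (fun x => f0 (phi x))).
Qed.

Definition average (l : R) j (g : T -> R) (t : T) : R :=
  fine (\int[normal_prob l sigma]_y (g (update t j y))%:E)%E.

Variable b : R.
(** These bounds make ln g nonnegative and bounded, so the integrals of g and ln g are finite. The
    application takes g = expR (s * \1_E) with s >= 0 and b = expR s. *)
Definition range1 (g : T -> R) := forall t, 1 <= g t <= b.

Lemma integrable_range1 l j g t : measurable_fun setT g -> range1 g ->
  (normal_prob l sigma).-integrable setT (fun y => (g (update t j y))%:E).
Proof.
move=> mg gb.
apply: (@bounded_integrable R _ _ (normal_prob l sigma) (fun y => g (update t j y)) b).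
  apply: measurableT_comp => //.
  apply: (@measurableT_comp _ _ _ _ _ _ (fun x : T * R => update x.1 j x.2) _
    (fun y => (t, y))).
    exact: measurable_update.
  exact: measurable_fun_pair.
move=> y; have /andP[g1 gb'] := gb (update t j y).
by rewrite ger0_norm// (le_trans _ g1).
Qed.

Lemma averageE l j g t : measurable_fun setT g -> range1 g ->
  (average l j g t)%:E = (\int[normal_prob l sigma]_y (g (update t j y))%:E)%E.
Proof.
by move=> mg gb; rewrite fineK//; apply/integrable_fin_num/integrable_range1.
Qed.

Lemma range1_average l j g : measurable_fun setT g -> range1 g ->
  range1 (average l j g).
Proof.
move=> mg gb t; rewrite -!lee_fin averageE//.
have cstE r : r%:E = (\int[normal_prob l sigma]_y r%:E)%E.
  rewrite integral_cst//; have /= N1 := probability_setT (normal_prob l sigma).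
  by rewrite -[LHS]mule1; congr (_ * _)%E; exact/esym/N1.
apply/andP; split; [rewrite [leLHS]cstE | rewrite [leRHS]cstE].
  apply: le_integral => //; first exact: finite_measure_integrable_cst.
    exact: integrable_range1.
  by move=> y _; rewrite lee_fin; have /andP[] := gb (update t j y).
apply: le_integral => //; first exact: integrable_range1.
  exact: finite_measure_integrable_cst.
by move=> y _; rewrite lee_fin; have /andP[] := gb (update t j y).
Qed.

Lemma measurable_average l j g : measurable_fun setT g -> range1 g ->
  measurable_fun setT (average l j g).
Proof.
move=> mg gb.
pose N := normal_prob l sigma.
pose phi (x : T * measurableTypeR R) := update x.1 j x.2.
have mphi : measurable_fun setT phi by exact: measurable_update.
have mgphi : measurable_fun setT (fun x => (g (phi x))%:E).
  by apply/measurable_EFinP; exact: measurableT_comp.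
apply: (@measurableT_comp _ _ _ _ _ _ fine) => //.
apply: (@measurable_fun_fubini_tonelli_F _ _ _ _ R N _ mgphi) => x.
by rewrite lee_fin (le_trans ler01)//; have /andP[] := gb (phi x).
Qed.

Lemma integral_average theta Q j g : sample_law theta Q ->
  measurable_fun setT g -> range1 g ->
  (\int[Q]_t (average (theta j) j g t)%:E = \int[Q]_t (g t)%:E)%E.
Proof.
move=> lawQ mg gb; rewrite [RHS](integral_resample j lawQ) //.
- by apply: eq_integral => t _; rewrite averageE.
- exact/measurable_EFinP.
- by move=> t; rewrite lee_fin (le_trans ler01)//; have /andP[] := gb t.
Qed.

(** Depending only on the seed and the first k samples is expressed as invariance under [agree k],
    in place of measurability for a filtration. *)
Definition agree (k : nat) t t' := t.1 = t'.1 /\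
  forall i : 'I_m, (i < k)%N -> tnth t.2 i = tnth t'.2 i.

Lemma agree_update k t t' j y : j = k :> nat -> agree k t t' ->
  agree k.+1 (update t j y) (update t' j y).
Proof.
move=> jk [t1 tt']; split => // i; rewrite ltnS !tnth_update => ik.
case: eqP => [//|/eqP ij]; apply: tt'; rewrite ltn_neqAle ik andbT.
by apply: contra ij => /eqP ik'; apply/eqP/val_inj; rewrite /= ik'.
Qed.

Lemma update_agree k t j y : (k <= j)%N -> agree k (update t j y) t.
Proof.
move=> kj; split => // i ik; rewrite tnth_update; case: eqP => // ij.
by move: ik; rewrite ij ltnNge kj.
Qed.

Lemma updateC t i j x y : i != j ->
  update (update t i x) j y = update (update t j y) i x.
Proof.
move=> ij; rewrite /update/=; congr (_, _); apply: eq_from_tnth => k.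
rewrite !tnth_mktuple; case: eqP => // ->; rewrite eq_sym.
by rewrite (negbTE ij).
Qed.

(** * Averaging out the samples in reverse order *)

Section sequential.
Hypothesis sigma_gt0 : 0 < sigma.
Variables (theta theta' : 'I_m -> R) (Q Q' : probability T R).
Hypotheses (lawQ : sample_law theta Q) (lawQ' : sample_law theta' Q').
Variable used : 'I_m -> T -> bool.
Hypothesis measurable_used : forall j, measurable [set t | used j t].
Hypothesis used_adapted : forall j t t', agree j t t' -> used j t = used j t'.

(** Term of sample j in the chain rule: the relative entropy of the two Gaussians times the
    probability under [Q] that the sample is used. *)
Let kl j : R :=
  (theta j - theta' j) ^+ 2 / (2 * sigma ^+ 2) * fine (Q [set t | used j t]).

Definition observable (k : nat) (g : T -> R) : Prop :=
  [/\ measurable_fun setT g, range1 g,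
   forall t t', agree k t t' -> g t = g t' &
   forall j t y, (j < k)%N -> ~~ used j t -> g (update t j y) = g t].

Lemma observable_average (k : 'I_m) g :
  observable k.+1 g -> observable k (average (theta' k) k g).
Proof.
move=> [mg gb gk gused]; split.
- exact: measurable_average.
- exact: range1_average.
- move=> t t' tt'; congr fine; apply: eq_integral => y _; congr (_%:E).
  by apply: gk; exact: agree_update.
- move=> j t y jk uj; congr fine; apply: eq_integral => z _; congr (_%:E).
  have jk' : j != k by apply/eqP => jk'; rewrite jk' ltnn in jk.
  rewrite updateC// gused//; first by rewrite ltnS ltnW.
  by rewrite (@used_adapted j _ t)//; apply: update_agree; exact: ltnW.
Qed.

Lemma ln_ge0_range1 g t : range1 g -> (0 <= (ln (g t))%:E)%E.
Proof. by move=> gb; rewrite lee_fin ln_ge0//; have /andP[] := gb t. Qed.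

Lemma measurable_ln_EFin (g : T -> R) : measurable_fun setT g ->
  measurable_fun setT (fun t => (ln (g t))%:E).
Proof. by move=> mg; apply/measurable_EFinP; exact: measurableT_comp. Qed.

(* An unused coordinate does not influence [g], hence averaging over it costs
   no relative entropy. *)
Lemma integral_ln_average (k : 'I_m) g : observable k.+1 g ->
  (\int[Q]_t (ln (g t))%:E <=
   \int[Q]_t (ln (average (theta' k) k g t))%:E + (kl k)%:E)%E.
Proof.
move=> og; have [mg gb _ gused] := og.
have [ma ab _ _] := observable_average og.
pose c := (theta k - theta' k) ^+ 2 / (2 * sigma ^+ 2).
have c0 : 0 <= c by rewrite divr_ge0 ?sqr_ge0// mulr_ge0 ?sqr_ge0.
have mused : measurable_fun setT (fun t => (\1_[set t | used k t] t : R)%:E).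
  by apply/measurable_EFinP/measurable_indic.
have -> : (\int[Q]_t (ln (average (theta' k) k g t))%:E + (kl k)%:E =
    \int[Q]_t ((ln (average (theta' k) k g t))%:E +
      c%:E * (\1_[set t | used k t] t)%:E))%E.
  rewrite ge0_integralD//=.
  - congr (_ + _)%E; rewrite ge0_integralZl//; last first.
    rewrite integral_indic// setIT /kl EFinM fineK//.
    exact: fin_num_measure.
  - by move=> t _; exact: ln_ge0_range1.
  - exact: measurable_ln_EFin.
  - by move=> t _; rewrite -EFinM lee_fin mulr_ge0.
  - exact: measurable_funeM.
(* Redrawing coordinate k under [Q] reduces the claim to a fixed t, where [normal_ln_le] compares
   the two laws of that coordinate alone. *)
rewrite (integral_resample k lawQ); last 2 first.
- exact: measurable_ln_EFin.
- by move=> t; exact: ln_ge0_range1.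
apply: ge0_le_integral => //=.
- by move=> t _; apply: integral_ge0 => y _; exact: ln_ge0_range1.
- pose phi (x : T * measurableTypeR R) := update x.1 k x.2.
  have mphi : measurable_fun setT phi by exact: measurable_update.
  have mgphi : measurable_fun setT (fun x => (ln (g (phi x)))%:E).
    apply/measurable_EFinP; apply: measurableT_comp => //.
    exact: measurableT_comp.
  apply: (@measurable_fun_fubini_tonelli_F _ _ _ _ R
    (normal_prob (theta k) sigma) _ mgphi) => x.
  exact: ln_ge0_range1.
- by apply: emeasurable_funD; [exact: measurable_ln_EFin|exact: measurable_funeM].
- move=> t _; rewrite indicE/=.
  have [ut|ut] := boolP (used k t).
    rewrite mem_set// mule1 -EFinD.
    apply: (@normal_ln_le R sigma sigma_gt0 (theta k) (theta' k)
      (fun y => g (update t k y)) b) => //.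
    apply: measurableT_comp => //.
    apply: (@measurableT_comp _ _ _ _ _ _ (fun x : T * R => update x.1 k x.2) _
      (fun y => (t, y))).
      exact: measurable_update.
    exact: measurable_fun_pair.
  rewrite memNset; last exact/negP.
  rewrite mule0 adde0.
  have gE y : g (update t k y) = g t by exact: gused.
  have cstE l r : (\int[normal_prob l sigma]_y r%:E = r%:E)%E.
    rewrite integral_cst//; have /= N1 := probability_setT (normal_prob l sigma).
    by rewrite -[RHS]mule1; congr (_ * _)%E; exact: N1.
  have -> : average (theta' k) k g t = g t.
    by rewrite /average; under eq_integral do rewrite gE; rewrite cstE.
  by under eq_integral do rewrite gE; rewrite cstE.
Qed.

(** The seed has law [nu] under every [sample_law], whatever the means; [v0] is an arbitrary filler
    for the samples. *)
Lemma integral_seed theta0 (Q0 : probability T R) (h : T -> \bar R) (v0 : m.-tuple R) :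
  sample_law theta0 Q0 -> measurable_fun setT h -> (forall t, 0 <= h t)%E ->
  (forall t t', t.1 = t'.1 -> h t = h t') ->
  (\int[Q0]_t h t = \int[nu]_u h (u, v0))%E.
Proof.
move=> law0 mh h0 h1.
have mpair : measurable_fun setT (fun u : S => (u, v0) : T).
  exact: measurable_fun_pair.
have mh' : measurable_fun setT (fun u => h (u, v0)) by exact: measurableT_comp.
transitivity (\int[pushforward Q0 fst]_u h (u, v0))%E.
  rewrite ge0_integral_pushforward//= preimage_setT.
  by apply: eq_integral => t _; exact: h1.
apply: eq_measure_integral => A mA _.
transitivity (Q0 (rectangle A (fun=> setT))).
  by congr (Q0 _); apply/seteqP; split => t /=; [|case].
by rewrite law0// big1 ?mule1// => j _; exact: probability_setT.
Qed.

(** Induction from the last sample backwards: averaging with respect to theta' keeps the integral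
    under [Q'], and costs [kl k] in the bound on the integral of the logarithm under [Q]. *)
Lemma observable_iter g : observable m g -> forall d, (d <= m)%N ->
  exists2 g', observable (m - d) g' &
    (\int[Q']_t (g' t)%:E = \int[Q']_t (g t)%:E)%E /\
    (\int[Q]_t (ln (g t))%:E <= \int[Q]_t (ln (g' t))%:E +
       (\sum_(k < m | (m - d <= k)%N) kl k)%:E)%E.
Proof.
move=> og; elim=> [_|d IH dm].
  exists g; rewrite ?subn0//; split => //.
  rewrite big_pred0 ?adde0// => k.
  by apply: negbTE; rewrite -ltnNge.
have [g' og' [gE gle]] := IH (ltnW dm).
have km : (m - d.+1 < m)%N by rewrite ltn_subrL (leq_ltn_trans _ dm).
pose k := Ordinal km.
have kE : k.+1 = (m - d)%N by rewrite /= subnSK.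
rewrite -kE in og' gle.
exists (average (theta' k) k g'); first exact: (@observable_average k).
have [mg' gb' _ _] := og'; split.
  by rewrite (integral_average k lawQ').
rewrite (le_trans gle)// [in leRHS](bigD1 k)//= EFinD addeA leeD//; last first.
  rewrite lee_fin le_eqVlt; apply/orP; left; apply/eqP.
  apply: eq_bigl => i; rewrite ltn_neqAle andbC; congr (_ && _).
  by rewrite eq_sym.
exact: integral_ln_average.
Qed.

(** Once all samples are averaged out, what remains depends on the seed only, whose law is common to
    [Q] and [Q']; Jensen's inequality for ln concludes. *)
Lemma donsker_varadhan g : observable m g ->
  (\int[Q]_t (ln (g t))%:E <=
   (ln (fine (\int[Q']_t (g t)%:E)) + \sum_k kl k)%:E)%E.
Proof.
move=> og; have [g' [mg' gb' gk _] [gE gle]] := observable_iter og (leqnn m).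
rewrite (le_trans gle)// EFinD leeD//; last first.
  by rewrite lee_fin subnn.
have g'0 t : 0 < g' t by have /andP[+ _] := gb' t; apply: lt_le_trans.
have gseed t t' : t.1 = t'.1 -> g' t = g' t'.
  by move=> tt'; apply: gk; split => // i; rewrite subnn.
have intg' : Q.-integrable setT (EFin \o g').
  apply: (@bounded_integrable _ _ _ Q g' b) => // t.
  by rewrite gtr0_norm//; have /andP[] := gb' t.
have gQ : (\int[Q']_t (g t)%:E = \int[Q]_t (g' t)%:E)%E.
  pose t0 : m.-tuple R := [tuple 0 | i < m].
  rewrite -gE (@integral_seed theta' _ _ t0 lawQ'); first last.
  - by move=> t t' /gseed ->.
  - by move=> t; rewrite lee_fin ltW.
  - exact/measurable_EFinP.
  rewrite (@integral_seed theta _ _ t0 lawQ)//.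
  - exact/measurable_EFinP.
  - by move=> t; rewrite lee_fin ltW.
  - by move=> t t' /gseed ->.
rewrite gQ; set a := fine _.
have aE : (\int[Q]_t (g' t)%:E = a%:E)%E.
  by rewrite /a fineK//; exact: integrable_fin_num.
have cstE r : (\int[Q]_t r%:E = r%:E)%E.
  rewrite integral_cst//; have /= N1 := probability_setT Q.
  by rewrite -[RHS]mule1; congr (_ * _)%E; exact: N1.
have a0 : 0 < a.
  rewrite (lt_le_trans ltr01)// -lee_fin -aE -[leLHS]cstE.
  apply: le_integral => //; first exact: finite_measure_integrable_cst.
  by move=> t _; rewrite lee_fin; have /andP[] := gb' t.
(* Jensen's inequality through the tangent of ln at a: ln y <= ln a - 1 + y / a, with equality in
   the mean. *)
have H : (ln a)%:E = (\int[Q]_t ((ln a - 1)%:E + a^-1%:E * (g' t)%:E))%E.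
  rewrite integralD//; last 2 first.
  - exact: finite_measure_integrable_cst.
  - exact: integrableZl.
  rewrite integralZl// cstE aE -EFinM -EFinD mulVf ?gt_eqF//.
  by rewrite subrK.
rewrite H; apply: le_integral => //.
- apply: (@bounded_integrable _ _ _ Q (fun t => ln (g' t)) (ln b)).
    exact: measurableT_comp.
  move=> t; have /andP[g1 gb1] := gb' t.
  by rewrite ger0_norm ?ln_ge0// ler_ln ?posrE// (lt_le_trans (g'0 t) gb1).
- apply: integrableD => //; first exact: finite_measure_integrable_cst.
  exact: integrableZl.
- move=> t _; rewrite -EFinM -EFinD lee_fin.
  have ga0 : 0 < g' t / a by rewrite divr_gt0.
  have := @le_ln1Dx R (g' t / a - 1); rewrite ltrBrDl subrr ga0 => /(_ isT).
  rewrite subrKC ln_div ?posrE// mulrC => ?; lra.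
Qed.

End sequential.

End resampling.

(** [donsker_varadhan] for g = expR (s * \1_E), followed by Hoeffding's lemma, gives s (p - q) <=
    s^2 / 8 + KL. *)
Lemma adaptive_pinsker {R : realType} {dS : measure_display}
  {S : measurableType dS} (nu : probability S R) (sigma : R) (m : nat)
  (sigma_gt0 : 0 < sigma) (theta theta' : 'I_m -> R)
  (Q Q' : probability (S * m.-tuple R)%type R)
  (used : 'I_m -> S * m.-tuple R -> bool) (E : set (S * m.-tuple R)) :
  sample_law nu sigma theta Q -> sample_law nu sigma theta' Q' ->
  (forall j, measurable [set t | used j t]) ->
  (forall (j : 'I_m) (t t' : S * m.-tuple R), agree j t t' -> used j t = used j t') ->
  measurable E ->
  (forall (j : 'I_m) t y, ~~ used j t -> E (update t j y) <-> E t) ->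
  fine (Q E) <= fine (Q' E) +
    Num.sqrt (2^-1 * \sum_j ((theta j - theta' j) ^+ 2 / (2 * sigma ^+ 2) *
      fine (Q [set t | used j t]))).
Proof.
move=> lawQ lawQ' mused usedP mE Eused.
set KL := \sum_j _; set p := fine (Q E); set q := fine (Q' E).
have [pq|pq] := leP p q; first by rewrite (le_trans pq)// lerDl sqrtr_ge0.
rewrite -lerBlDl; set D := p - q.
have D0 : 0 < D by rewrite subr_gt0.
(* This s maximises s D - s^2 / 8, with value 2 D^2. *)
pose s := 4 * D; have s0 : 0 <= s by rewrite mulr_ge0// ltW.
pose g (t : S * m.-tuple R) : R := expR (s * \1_E t).
have lng t : ln (g t) = s * \1_E t by rewrite expRK.
have gE t : g t = 1 + (expR s - 1) * \1_E t.
  rewrite /g indicE; case: (t \in E); first by rewrite !mulr1 subrKC.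
  by rewrite !mulr0 expR0 addr0.
have es1 : 1 <= expR s by rewrite -expR0 ler_expR.
have og : observable (expR s) used m g.
  split.
  - by apply: measurableT_comp => //; exact: measurable_funM.
  - move=> t; rewrite gE indicE; case: (t \in E).
      by rewrite mulr1 subrKC lexx andbT.
    by rewrite mulr0 addr0 lexx.
  - move=> [u v] [u' v'] [/= -> vv']; congr (g (_, _)).
    by apply: eq_from_tnth => i; exact: vv'.
  - move=> j t y _ uj; rewrite /g !indicE; congr (expR (_ * _%:R)).
    congr nat_of_bool; apply/idP/idP; rewrite !inE => ?.
      by rewrite -(Eused j t y).
    by rewrite (Eused j t y).
have := donsker_varadhan sigma_gt0 lawQ lawQ' mused usedP og.
rewrite -/KL.
have m1 : measurable_fun setT (fun t => (\1_E t : R)%:E).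
  by apply/measurable_EFinP/measurable_indic.
have -> : (\int[Q]_t (ln (g t))%:E = (s * p)%:E)%E.
  under eq_integral do rewrite lng EFinM.
  rewrite ge0_integralZl//.
  rewrite [RHS]EFinM; congr (_ * _)%E.
  by rewrite integral_indic// setIT; apply/esym/fineK/fin_num_measure.
have -> : fine (\int[Q']_t (g t)%:E)%E = 1 - q + q * expR s.
  under eq_integral do rewrite gE EFinD EFinM.
  rewrite ge0_integralD//=; last 2 first.
  - by move=> t _; rewrite -EFinM lee_fin mulr_ge0// subr_ge0.
  - exact: measurable_funeM.
  have cstE : (\int[Q']_t (1 : \bar R) = 1)%E.
    by rewrite integral_cst// mul1e; exact: probability_setT.
  have indE : (\int[Q']_t (\1_E t : R)%:E = q%:E)%E.
    by rewrite integral_indic// setIT; apply/esym/fineK/fin_num_measure.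
  have es0 : 0 <= expR s - 1 by rewrite subr_ge0.
  by rewrite (ge0_integralZl _ _ m1)//= cstE indE/=; ring.
have q01 : 0 <= q <= 1.
  rewrite /q -!lee_fin fineK ?fin_num_measure// measure_ge0/=.
  exact: probability_le1.
rewrite lee_fin => /le_trans/(_ (lerD (ln_bernoulli_le q01 s0) (lexx KL))).
rewrite /s => H.
have DKL : D ^+ 2 <= 2^-1 * KL.
  by move: H; rewrite -[p](subrK q) -/D => H; lra.
by rewrite -[leLHS](gtr0_norm D0) -sqrtr_sqr ler_wsqrtr.
Qed.

(** * Runs of a batched algorithm *)

Section run.
Context {R : realType} {K : nat} {dS : measure_display}
  {S : measurableType dS} {I : Type}.
Variable alg : batched_algorithm R K S I.
Implicit Types (u : S) (x : nat -> 'I_K -> nat -> R).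

Definition batch_size u x r : nat := (\sum_(i < K) alloc alg (u, run alg u x r) i)%N.
Definition drawn u x r : nat := total_samples (run alg u x r).

Lemma drawn0 u x : drawn u x 0 = 0%N.
Proof. by rewrite /drawn/= /total_samples big_nil. Qed.

Lemma drawnS u x r : drawn u x r.+1 = (drawn u x r + batch_size u x r)%N.
Proof.
rewrite /drawn /total_samples /= -cats1 big_cat big_seq1/=; congr (_ + _)%N.
by apply: eq_bigr => i _; rewrite tnth_mktuple size_map size_iota.
Qed.

Lemma leq_drawn u x r s : (r <= s)%N -> (drawn u x r <= drawn u x s)%N.
Proof.
move=> /subnKC <-; elim: (s - r)%N => [|d IH]; first by rewrite addn0.
by rewrite addnS drawnS (leq_trans IH)// leq_addr.
Qed.

Lemma alloc_le_drawn u x r i : (alloc alg (u, run alg u x r) i <= drawn u x r.+1)%N.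
Proof. by rewrite drawnS /batch_size (bigD1 i)//= addnCA leq_addr. Qed.

Lemma run_ext u x x' n :
  (forall r i k, (r < n)%N -> (k < alloc alg (u, run alg u x r) i)%N ->
    x r i k = x' r i k) ->
  run alg u x n = run alg u x' n.
Proof.
elim: n => [//|n IH] xx' /=.
rewrite -IH; last by move=> r i k rn; apply: xx'; rewrite ltnS ltnW.
congr rcons; apply: eq_from_tnth => i; rewrite !tnth_mktuple.
by apply/eq_in_map => k; rewrite mem_iota => /andP[_ ka]; exact: xx'.
Qed.

Lemma run_prefix u x x' n r : (r <= n)%N ->
  run alg u x n = run alg u x' n -> run alg u x r = run alg u x' r.
Proof.
move=> /subnKC <-; elim: (n - r)%N => [|d IH]; first by rewrite addn0.
by rewrite addnS /= => /rcons_inj[/IH].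
Qed.

(** A batch reads the samples of an arm in the order of their index, so with at most [C] draws in
    all only indices below [C] are read. *)
Lemma run_ext_drawn u x x' n C : (drawn u x n <= C)%N ->
  (forall r i k, (r < n)%N -> (k < C)%N -> x r i k = x' r i k) ->
  run alg u x n = run alg u x' n.
Proof.
move=> xC xx'; apply: run_ext => r i k rn ka; apply: xx' => //.
by rewrite (leq_trans ka)// (leq_trans (alloc_le_drawn _ _ _ _))//
  (leq_trans _ xC)// leq_drawn.
Qed.

(** * Measurability of the run *)

Section measurability.
Context {d : measure_display} {Om : measurableType d}.
Variables (u : Om -> S) (x : nat -> 'I_K -> nat -> Om -> R).
Hypotheses (mu : measurable_fun setT u)
  (mx : forall r i k, measurable_fun setT (x r i k)).
Local Notation samples om := (fun r i k => x r i k om).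

Lemma measurable_samples r i c :
  measurable_fun setT (fun om => [seq x r i k om | k <- iota 0 c]).
Proof.
have mt : measurable_fun setT (fun om => [tuple x r i k om | k < c]).
  apply/measurable_fun_tnthP => k.
  rewrite (_ : _ \o _ = x r i k)//.
  by apply/funext => om; rewrite /= tnth_mktuple.
have sE om : [seq x r i k om | k <- iota 0 c] = [tuple x r i k om | k < c].
  by rewrite /= -val_enum_ord -map_comp.
move=> _ A mA; have := mt measurableT _ (mA c); rewrite !setTI.
congr (measurable _); apply/seteqP; split => om /=; rewrite sE; exact.
Qed.

(** The level sets of f form a countable partition, on each piece of which the map is a fixed g c.
    This handles batches of random size. *)
Lemma measurable_by_count d' (T' : measurableType d') (C : countType)
    (f : Om -> C) (g : C -> Om -> T') :
  (forall c, measurable (f @^-1` [set c])) ->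
  (forall c, measurable_fun setT (g c)) ->
  measurable_fun setT (fun om => g (f om) om).
Proof.
move=> mf mg _ A mA; rewrite setTI.
rewrite (_ : _ @^-1` _ = \bigcup_(c in [set: C]) (f @^-1` [set c] `&` g c @^-1` A)).
  apply: countable_bigcupT_measurable; first exact: countableP.
  move=> c; apply: measurableI => //.
  by rewrite -[X in measurable X]setTI; exact: mg.
apply/seteqP; split => [om Aom|om [c _ []] /= <- //].
by exists (f om).
Qed.

(** After r batches the history has exactly r entries, so measurability can be checked entry by
    entry on tuples. The random sizes in the last batch are dealt with by splitting along the values
    of the allocation. *)
Lemma measurable_run_tuple r : exists2 h : Om -> r.-tuple (K.-tuple (seq R)),
  measurable_fun setT h & forall om, run alg (u om) (samples om) r = tval (h om).
Proof.
elim: r => [|r [h mh hE]].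
  exists (fun=> [tuple]); first exact: measurable_cst.
  by [].
have mval : measurable_fun setT (fun om => tval (h om) : history R K).
  by move=> _ A mA; exact: (mh measurableT _ (mA r)).
have mpair : measurable_fun setT (fun om => (u om, tval (h om) : history R K)).
  exact: measurable_fun_pair.
have malloc a : measurable ((fun om => alloc alg (u om, tval (h om))) @^-1` [set a]).
  have := mpair measurableT _ (measurable_alloc alg a); rewrite setTI; exact.
pose b om : K.-tuple (seq R) := [tuple
  [seq x r i k om | k <- iota 0 (alloc alg (u om, tval (h om)) i)] | i < K].
have mb : measurable_fun setT b.
  apply/measurable_fun_tnthP => i.
  rewrite (_ : _ \o _ = fun om => [seq x r i k om |
      k <- iota 0 (alloc alg (u om, tval (h om)) i)]); last first.
    by apply/funext => om; rewrite /= tnth_mktuple.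
  apply: (@measurable_by_count _ _ _ _ (fun (a : {ffun 'I_K -> nat}) om =>
    [seq x r i k om | k <- iota 0 (a i)]) malloc).
  by move=> a; exact: measurable_samples.
exists (fun om => [tuple of rcons (h om) (b om)]); last first.
  by move=> om /=; rewrite hE.
apply/measurable_fun_tnthP => i.
have [ir|ir] := ltnP i r.
  rewrite (_ : _ \o _ = fun om => tnth (h om) (Ordinal ir)).
    apply: (@measurableT_comp _ _ _ _ _ _ (fun v => tnth v (Ordinal ir))) => //.
    exact: measurable_tnth.
  apply/funext => om /=.
  by rewrite !(tnth_nth [tuple [::] | i < K])/= nth_rcons size_tuple ir.
rewrite (_ : _ \o _ = b)//.
apply/funext => om /=.
have ir' : i = r :> nat by apply/eqP; rewrite eqn_leq ir -ltnS ltn_ord.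
by rewrite (tnth_nth [tuple [::] | i < K])/= nth_rcons size_tuple ir' ltnn eqxx.
Qed.

Lemma measurable_pair_run r :
  measurable_fun setT (fun om => (u om, run alg (u om) (samples om) r)).
Proof.
have [h mh hE] := measurable_run_tuple r.
apply: measurable_fun_pair => //; rewrite (funext hE).
by move=> _ A mA; exact: (mh measurableT _ (mA r)).
Qed.

Lemma measurable_run_event r (D : set (S * history R K)) :
  measurable D -> measurable [set om | D (u om, run alg (u om) (samples om) r)].
Proof.
by move=> mD; have := measurable_pair_run r measurableT mD; rewrite setTI.
Qed.

Lemma measurable_alloc_run r i :
  measurable_fun setT (fun om => alloc alg (u om, run alg (u om) (samples om) r) i).
Proof.
apply: (@measurable_by_count _ _ _ _
  (fun a : {ffun 'I_K -> nat} => fun=> a i)).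
  by move=> a; exact: measurable_run_event (measurable_alloc alg a).
by move=> a; exact: measurable_cst.
Qed.

Lemma measurable_drawn r : measurable_fun setT (fun om => drawn (u om) (samples om) r).
Proof.
elim: r => [|r IH].
  rewrite (_ : (fun=> _) = fun=> 0%N)//.
  by apply/funext => om; rewrite drawn0.
rewrite (_ : (fun=> _) = fun om =>
    (drawn (u om) (samples om) r + batch_size (u om) (samples om) r)%N).
  apply: measurable_fun_addn => //.
  rewrite /batch_size; elim: (index_enum 'I_K) => [|i l IHl].
    rewrite (_ : (fun=> _) = fun=> 0%N)//.
    by apply/funext => om; rewrite big_nil.
  rewrite [X in measurable_fun _ X](funext (fun om => big_cons _ _ _ _ _ _)).
  by apply: measurable_fun_addn => //; exact: measurable_alloc_run.
by apply/funext => om; rewrite drawnS.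
Qed.

End measurability.

(** * Change of instance for events decided by finitely many batches *)

Section transport.
Variables (n C : nat).

(* The samples that a run can use within its first [n] batches while drawing
   at most [C] samples, in order of their batch. *)
Definition slots : seq (nat * 'I_K * nat) :=
  sort (fun a b => a.1.1 <= b.1.1)%N
    [seq (a, k) | a <- [seq (r, i) | r <- iota 0 n, i <- enum 'I_K], k <- iota 0 C].

Lemma mem_slots r i k : ((r, i, k) \in slots) = (r < n)%N && (k < C)%N.
Proof.
rewrite mem_sort; apply/allpairsP/andP => [[[a l] /= [/allpairsP[[r' i'] /=]]]|[rn kC]].
  rewrite !mem_iota => -[rn _ ->] lC [-> _ ->]; split; by [].
exists ((r, i), k); split => //; last by rewrite mem_iota.
by apply/allpairsP; exists (r, i); rewrite mem_iota rn mem_enum.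
Qed.

Lemma uniq_slots : uniq slots.
Proof.
rewrite sort_uniq; apply: allpairs_uniq; [|exact: iota_uniq|by move=> [? ?] [? ?]].
by apply: allpairs_uniq; [exact: iota_uniq|exact: enum_uniq|move=> [? ?] [? ?]].
Qed.

(** Sorting by batch makes usage adapted: whether a slot is used depends on earlier batches, whose
    slots come earlier in the list. *)
Lemma slots_index a b : a \in slots -> b \in slots -> (a.1.1 < b.1.1)%N ->
  (index a slots < index b slots)%N.
Proof.
move=> ain bin; apply: contraTT; rewrite -!leqNgt => ba.
have tot : total (fun a b : nat * 'I_K * nat => a.1.1 <= b.1.1)%N.
  by move=> ? ?; exact: leq_total.
have tr : transitive (fun a b : nat * 'I_K * nat => a.1.1 <= b.1.1)%N.
  by move=> ? ? ?; exact: leq_trans.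
have st : sorted (fun a b => a.1.1 <= b.1.1)%N slots by exact: sort_sorted.
have := sorted_leq_nth tr (fun _ => leqnn _) a st.
move=> /(_ (index b slots) (index a slots)).
rewrite !inE !index_mem => /(_ bin ain ba).
by rewrite !nth_index.
Qed.

Notation m := (size slots).
Notation T := (S * m.-tuple R)%type.
Let slot (j : 'I_m) := tnth (in_tuple slots) j.

Let slot_in j : slot j \in slots.
Proof. exact: mem_tnth. Qed.

Let index_slot j : index (slot j) slots = j.
Proof. by rewrite /slot (tnth_nth (slot j))/= index_uniq// uniq_slots. Qed.

(** Samples outside of [slots] read as 0; the first n batches never reach them as long as they draw
    at most [C] samples. *)
Let unslot (v : m.-tuple R) r i k : R := nth 0 v (index (r, i, k) slots).

Let unslotE v j : unslot v (slot j).1.1 (slot j).1.2 (slot j).2 = tnth v j.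
Proof.
by rewrite /unslot -!surjective_pairing index_slot -tnth_nth.
Qed.

Let slotP r i k : (r < n)%N -> (k < C)%N -> exists j, slot j = (r, i, k).
Proof.
move=> rn kC; have ain : (r, i, k) \in slots by rewrite mem_slots rn.
have jm : (index (r, i, k) slots < m)%N by rewrite index_mem.
by exists (Ordinal jm); rewrite /slot (tnth_nth (r, i, k))/= nth_index.
Qed.

Let measurable_unslot r i k :
  measurable_fun setT (fun t : T => unslot t.2 r i k).
Proof.
have [ain|ain] := boolP ((r, i, k) \in slots).
  have jm : (index (r, i, k) slots < m)%N by rewrite index_mem.
  rewrite (_ : (fun=> _) = fun t : T => tnth t.2 (Ordinal jm)).
    apply: (@measurableT_comp _ _ _ _ _ _
      (fun v : m.-tuple R => tnth v (Ordinal jm))) => //.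
    exact: measurable_tnth.
  by apply/funext => t; rewrite (tnth_nth 0).
rewrite (_ : (fun=> _) = fun=> 0)//.
apply/funext => t; rewrite /unslot nth_default// size_tuple.
by rewrite leqNgt index_mem.
Qed.

(** Batch r counts only if the total after it is at most [C]. By [drawnS] that total is determined
    by the seed and the first r batches, so the truncation stays adapted. *)
Let used (j : 'I_m) (t : T) : bool :=
  let: (r, i, k) := slot j in
  (drawn t.1 (unslot t.2) r.+1 <= C)%N &&
  (k < alloc alg (t.1, run alg t.1 (unslot t.2) r) i)%N.

Let used_adapted (j : 'I_m) (t t' : T) : agree j t t' -> used j t = used j t'.
Proof.
move=> [t1 tt']; rewrite /used; case sj : (slot j) => [[r i] k].
rewrite !drawnS /drawn /batch_size -t1.
have -> // : run alg t.1 (unslot t.2) r = run alg t.1 (unslot t'.2) r.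
apply: run_ext => r' i' k' r'r _.
have [ain|ain] := boolP ((r', i', k') \in slots); last first.
  by rewrite /unslot !nth_default// size_tuple leqNgt index_mem.
have ij : (index (r', i', k') slots < j)%N.
  by rewrite -(index_slot j) slots_index// sj.
have im := ltn_trans ij (ltn_ord j).
by have := tt' (Ordinal im) ij; rewrite !(tnth_nth 0).
Qed.

Let measurable_used j : measurable [set t | used j t].
Proof.
rewrite /used; case: (slot j) => [[r i] k].
rewrite (_ : mkset _ = [set t : T | (drawn t.1 (unslot t.2) r.+1 <= C)%N] `&`
  [set t : T | (k < alloc alg (t.1, run alg t.1 (unslot t.2) r) i)%N]); last first.
  by apply/seteqP; split => t /= => [/andP[]|[-> ->]].
apply: measurableI.
  have := measurable_drawn measurable_fst (fun r i k => measurable_unslot r i k) r.+1.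
  by move=> /(_ measurableT [set c | (c <= C)%N] Logic.I); rewrite setTI.
have := measurable_alloc_run measurable_fst (fun r i k => measurable_unslot r i k) r i.
by move=> /(_ measurableT [set c | (k < c)%N] Logic.I); rewrite setTI.
Qed.

Let sum_lt_le a c : (\sum_(k <- iota 0 c) (k < a)%N <= a)%N.
Proof.
rewrite -[c in iota 0 c]subn0 -/(index_iota 0 c) big_mkord.
elim: c a => [|c IH] a; first by rewrite big_ord0.
case: a => [|a]; first by rewrite big1.
by rewrite big_ord_recl /= add1n ltnS; exact: IH.
Qed.

Let sum_used t : (\sum_(j < m) used j t <= C)%N.
Proof.
case: t => u v.
pose f (a : nat * 'I_K * nat) : nat := (drawn u (unslot v) a.1.1.+1 <= C)%N &&
  (a.2 < alloc alg (u, run alg u (unslot v) a.1.1) a.1.2)%N.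
have -> : (\sum_(j < m) used j (u, v) = \sum_(a <- slots) f a)%N.
  rewrite [RHS](big_tnth _ _ slots)/=; apply: eq_bigr => j _.
  by rewrite /used /f /slot; case: (tnth _ j) => [[? ?] ?].
rewrite (perm_big _ (permEl (perm_sort _ _))) big_allpairs big_allpairs/=.
apply: (@leq_trans (\sum_(0 <= r < n)
    (drawn u (unslot v) r.+1 <= C)%N * batch_size u (unslot v) r)%N).
  rewrite /index_iota subn0; apply: leq_sum => r _.
  rewrite /batch_size big_distrr big_enum/=; apply: leq_sum => i _.
  rewrite /f/=; case: (_ <= C)%N => /=; last by rewrite big1.
  by rewrite mul1n; exact: sum_lt_le.
(* Strengthened to a minimum for the induction: while the total stays within [C] the sum is bounded
   by the total, and afterwards it no longer grows. *)
suff: (\sum_(0 <= r < n)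
    (drawn u (unslot v) r.+1 <= C)%N * batch_size u (unslot v) r <=
    minn C (drawn u (unslot v) n))%N by rewrite leq_min => /andP[].
elim: n => [|n' IH]; first by rewrite big_geq.
rewrite big_nat_recr//= leq_min.
case: (leqP (drawn u (unslot v) n'.+1) C) => dC.
  have le : (\sum_(0 <= i < n') (drawn u (unslot v) i.+1 <= C) *
      batch_size u (unslot v) i + batch_size u (unslot v) n' <=
      drawn u (unslot v) n'.+1)%N.
    by rewrite drawnS leq_add2r (leq_trans IH) ?geq_minr.
  by rewrite mul1n le (leq_trans le).
rewrite mul0n addn0 (leq_trans IH) ?geq_minl//=.
by rewrite (leq_trans IH)// (leq_trans (geq_minr _ _))// leq_drawn.
Qed.

Section law.
Context {dW : measure_display} {W : measurableType dW}.
Variables (nu : probability S R) (U : {mfun W >-> S})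
  (X : nat -> 'I_K -> nat -> {mfun W >-> R}) (sigma : R).
Hypothesis sigma_gt0 : 0 < sigma.

Let view (om : W) : T :=
  (U om, [tuple X (slot j).1.1 (slot j).1.2 (slot j).2 om | j < m]).

Let measurable_view : measurable_fun setT view.
Proof.
apply: measurable_fun_pair => //; apply/measurable_fun_tnthP => j.
rewrite (_ : _ \o _ = X (slot j).1.1 (slot j).1.2 (slot j).2)//.
by apply/funext => om; rewrite /= tnth_mktuple.
Qed.

HB.instance Definition _ := isMeasurableFun.Build _ _ _ _ view measurable_view.

Let law (P : probability W R) : probability T R := distribution P view.

Let sample_law_view mu (P : probability W R) :
  gaussian_bandit nu U X sigma mu P ->
  sample_law nu sigma (fun j => mu 0 (slot j).1.2) (law P).
Proof.
move=> bandit A B mA mB.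
(* [B] is indexed by positions in [slots]; [B'] carries it over to samples, leaving those outside of
   [slots] unconstrained. *)
pose B' a := oapp B setT (insub (index a slots)).
have B'E j : B' (slot j) = B j.
  by rewrite /B' index_slot valK.
have mB' a : measurable (B' a).
  by rewrite /B'; case: (insub _) => [j|] /=; [exact: mB|exact: measurableT].
have := bandit [fset a in slots]%fset A B' mA mB'.
rewrite (perm_big slots)/=; last first.
  by apply: uniq_perm; [exact: fset_uniq|exact: uniq_slots|move=> a; rewrite inE].
rewrite (big_tnth _ _ slots)/= => banditE.
transitivity (nu A * \prod_(j < m) normal_prob (mu 0%R (slot j).1.2) sigma
    (B' (slot j)))%E; last first.
  by congr (_ * _)%E; apply: eq_bigr => j _; rewrite B'E.
rewrite -banditE; congr (P _); apply/seteqP; split => om /= [UA XB]; split => //.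
  move=> a; rewrite in_fset/= => /(nthP a)[j jm <-].
  have := XB (Ordinal jm); rewrite tnth_mktuple -B'E.
  by rewrite /slot !(tnth_nth a).
move=> j; rewrite tnth_mktuple -B'E; apply: XB.
by rewrite in_fset/= slot_in.
Qed.

(* [w i] is the expected number of samples of arm [i] under [mu], each batch
   counting only if it keeps the total below [C]. It is chosen before [lam],
   which can therefore be adapted to it. *)
Lemma transport mu (P : probability W R) :
  gaussian_bandit nu U X sigma mu P ->
  exists w : 'I_K -> R, [/\ forall i, 0 <= w i, \sum_i w i <= C%:R &
    forall lam (P' : probability W R) (E : S -> (nat -> 'I_K -> nat -> R) -> Prop),
    gaussian_bandit nu U X sigma lam P' ->
    (forall u x, E u x -> (drawn u x n <= C)%N) ->
    (forall u x x', run alg u x n = run alg u x' n -> E u x -> E u x') ->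
    (forall d (Om : measurableType d) (u : Om -> S)
      (x : nat -> 'I_K -> nat -> Om -> R), measurable_fun setT u ->
      (forall r i k, measurable_fun setT (x r i k)) ->
      measurable [set om | E (u om) (fun r i k => x r i k om)]) ->
    fine (P [set om | E (U om) (fun r i k => X r i k om)]) <=
    fine (P' [set om | E (U om) (fun r i k => X r i k om)]) +
    Num.sqrt (2^-1 * \sum_i w i *
      ((mu 0 i - lam 0 i) ^+ 2 / (2 * sigma ^+ 2)))].
Proof.
move=> bandit.
pose q j := fine (law P [set t | used j t]).
have q0 j : 0 <= q j by exact: fine_ge0.
exists (fun i => \sum_(j < m | (slot j).1.2 == i) q j); split.
- by move=> i; exact: sumr_ge0.
- have -> : \sum_i \sum_(j < m | (slot j).1.2 == i) q j = \sum_j q j.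
    by rewrite [RHS](partition_big (fun j => (slot j).1.2) xpredT).
  rewrite -lee_fin -sumEFin.
  have usedE j : (fun t => ((used j t)%:R : R)%:E) =
      (fun t => (\1_[set t | used j t] t)%:E).
    apply/funext => t; rewrite indicE; congr (_%:R%:E); congr nat_of_bool.
    by apply/idP/idP; rewrite inE.
  have qE j : (q j)%:E = (\int[law P]_t ((used j t)%:R)%:E)%E.
    rewrite usedE integral_indic// setIT; exact/fineK/fin_num_measure.
  have mused j : measurable_fun setT (fun t => ((used j t)%:R : R)%:E).
    by rewrite usedE; exact/measurable_EFinP/measurable_indic.
  under eq_bigr do rewrite qE.
  rewrite -ge0_integral_sum//.
  have -> : (C%:R%:E = \int[law P]_t (C%:R : R)%:E)%E.
    rewrite integral_cst//; have /= P1 := probability_setT (law P).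
    by rewrite -[LHS]mule1; congr (_ * _)%E; exact/esym/P1.
  apply: ge0_le_integral => //.
  + by move=> t _; apply: sume_ge0.
  + exact: emeasurable_sum.
  + by move=> t _; rewrite sumEFin lee_fin -natr_sum ler_nat sum_used.
- move=> lam P' E bandit' EC Erun mE.
  pose E' : set T := [set t | E t.1 (unslot t.2)].
  have mE' : measurable E' by apply: mE => // r i k; exact: measurable_unslot.
  (* Since the event itself bounds the number of draws by [C], it survives any change of the samples
     outside of [slots], in both directions. *)
  have viewE : [set om | E (U om) (fun r i k => X r i k om)] = view @^-1` E'.
    have XE om r i k : (r < n)%N -> (k < C)%N -> X r i k om = unslot (view om).2 r i k.
      move=> rn kC; have [j sj] := slotP i rn kC.
      have := unslotE (view om).2 j; rewrite sj/= => ->.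
      by rewrite tnth_mktuple sj.
    apply/seteqP; split => om /= Eom; apply: (Erun _ _ _ _ Eom).
      exact: (run_ext_drawn (EC _ _ Eom) (XE om)).
    by apply: (run_ext_drawn (EC _ _ Eom)) => r i k rn kC; rewrite -XE.
  rewrite viewE.
  have E'upd j t y : ~~ used j t -> E' t -> E' (update t j y).
    move=> uj Et; apply: (Erun _ _ _ _ Et); rewrite /=; apply: run_ext => r i k rn ka.
    have kC := leq_trans ka (leq_trans (alloc_le_drawn _ _ _ _)
      (leq_trans (leq_drawn _ _ rn) (EC _ _ Et))).
    have [j' sj'] := slotP i rn kC.
    have := unslotE (update t j y).2 j'; have := unslotE t.2 j'.
    rewrite sj'/= => -> ->; rewrite tnth_update; case: eqP => // jj'.
    move: uj; rewrite /used -jj' sj' ka andbT.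
    by rewrite (leq_trans (leq_drawn _ _ rn) (EC _ _ Et)).
  have E'used j t y : ~~ used j t -> E' (update t j y) <-> E' t.
    move=> uj; split; last exact: E'upd.
    have uj' : ~~ used j (update t j y).
      by rewrite (@used_adapted j _ t)//; exact: update_agree.
    move=> /(E'upd _ _ (tnth t.2 j) uj').
    have -> // : update (update t j y) j (tnth t.2 j) = t.
    rewrite [RHS]surjective_pairing; congr (_, _); apply: eq_from_tnth => i.
    by rewrite tnth_mktuple tnth_update; case: eqP => [->|].
  have := adaptive_pinsker sigma_gt0 (sample_law_view bandit)
    (sample_law_view bandit') measurable_used used_adapted mE' E'used.
  congr (_ <= _ + Num.sqrt (_ * _)).
  rewrite (partition_big (fun j => (slot j).1.2) xpredT)//=.
  apply: eq_bigr => i _; rewrite big_distrl/=; apply: eq_bigr => j /eqP <-.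
  by rewrite mulrC.
Qed.

End law.
End transport.
End run.

(** * The lower bound *)

Section complexity_bounds.
Context {R : realType} {K : nat}.
Implicit Types (mu lam : 'rV[R]_K) (w : 'I_K -> R).

Let vertex (i : 'I_K) : 'rV[R]_K := \row_j (j == i)%:R.

Let vertex_simplex i : simplex (vertex i).
Proof.
split=> [j|]; first by rewrite mxE ler0n.
under eq_bigr do rewrite mxE.
by rewrite (bigD1 i)//= eqxx big1 ?addr0// => j /negbTE ->.
Qed.

Let wdiv_vertex sigma mu lam i : wdiv sigma (vertex i) mu lam =
  (mu 0 i - lam 0 i) ^+ 2 / (2 * sigma ^+ 2).
Proof.
rewrite /wdiv (bigD1 i)//= mxE eqxx mul1r big1 ?addr0// => j /negbTE ji.
by rewrite mxE ji mul0r.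
Qed.

(* [(1 - zeta)^-1 > 1] leaves room for an instance that only approaches the
   infimum defining [Tstar]. *)
Lemma exists_confusing_instance sigma (I : Type) (M : set 'rV[R]_K)
    (istar : 'rV[R]_K -> I) mu (T zeta c : R) w : (0 < K)%N ->
  Tstar sigma M istar mu = T%:E -> 0 < T -> 0 < zeta < 1 ->
  (forall i, 0 <= w i) -> \sum_i w i <= c ->
  exists2 lam, alt M istar mu lam &
    \sum_i w i * ((mu 0 i - lam 0 i) ^+ 2 / (2 * sigma ^+ 2)) <=
    c / (T * (1 - zeta)).
Proof.
move=> K0 TE T0 /andP[z0 z1] w0 wc.
set s := \sum_i w i in wc.
have s0 : 0 <= s by exact: sumr_ge0.
(* [w] is normalised to a point of the simplex. If its total s is 0, any point will do, as only w =
   s v matters. *)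
pose v : 'rV[R]_K := if s == 0 then vertex (Ordinal K0) else \row_i (w i / s).
have vS : simplex v.
  rewrite /v; case: eqP => [_|/eqP sn0]; first exact: vertex_simplex.
  split=> [i|]; first by rewrite mxE divr_ge0.
  under eq_bigr do rewrite mxE.
  by rewrite -mulr_suml divff.
have wv i : w i = s * v 0 i.
  rewrite /v; case: eqP => [se|/eqP sn0]; last by rewrite mxE mulrC divfK.
  rewrite se mul0r; move: se => /eqP; rewrite psumr_eq0// => /allP/(_ i).
  by rewrite mem_index_enum => /(_ isT)/eqP.
have supE : ereal_sup [set ereal_inf [set (wdiv sigma w mu lambda)%:E
      | lambda in alt M istar mu] | w in simplex] = (T^-1)%:E.
  by rewrite -[LHS]inveK -/(Tstar sigma M istar mu) TE inver gt_eqF.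
have : (ereal_inf [set (wdiv sigma v mu lambda)%:E | lambda in alt M istar mu]
    < ((T * (1 - zeta))^-1)%:E)%E.
  apply: (@le_lt_trans _ _ (T^-1)%:E).
    by rewrite -supE; apply: ereal_sup_ubound; exists v.
  rewrite lte_fin ltf_pV2 ?posrE ?mulr_gt0 ?subr_gt0//.
  by rewrite -[ltRHS]mulr1 ltr_pM2l// ltrBlDr ltrDl.
move=> /ereal_inf_lt[_ [lam lamA <-]]; rewrite lte_fin => wlt.
exists lam => //.
have -> : \sum_i w i * ((mu 0 i - lam 0 i) ^+ 2 / (2 * sigma ^+ 2)) =
    s * wdiv sigma v mu lam.
  by rewrite /wdiv big_distrr/=; apply: eq_bigr => i _; rewrite [RHS]mulrA -wv.
have v0 : 0 <= (T * (1 - zeta))^-1 by rewrite invr_ge0 mulr_ge0 ?subr_ge0// ltW.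
by rewrite (le_trans (ler_wpM2l s0 (ltW wlt)))// ler_wpM2r.
Qed.

(** The vertices of the simplex show that the supremum dominates the divergence of every single arm.
    It is at most the sum of these divergences, hence finite, and [fine] keeps its value. *)
Lemma sum_le_sup_wdiv sigma mu lam w (c : R) : (0 < K)%N ->
  (forall i, 0 <= w i) -> \sum_i w i <= c ->
  \sum_i w i * ((mu 0 i - lam 0 i) ^+ 2 / (2 * sigma ^+ 2)) <=
  c * fine (ereal_sup [set (wdiv sigma v lam mu)%:E | v in simplex]).
Proof.
move=> K0 w0 wc; set sup := ereal_sup _.
pose k i := (mu 0 i - lam 0 i) ^+ 2 / (2 * sigma ^+ 2).
have k0 i : 0 <= k i by rewrite divr_ge0 ?sqr_ge0// mulr_ge0 ?sqr_ge0.
have kE i : k i = (lam 0 i - mu 0 i) ^+ 2 / (2 * sigma ^+ 2).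
  by rewrite /k -sqrrN opprB.
have ksup i : ((k i)%:E <= sup)%E.
  by apply: ereal_sup_ubound; exists (vertex i) => //; rewrite wdiv_vertex kE.
have supfin : sup \is a fin_num.
  rewrite ge0_fin_numE; last by rewrite (le_trans _ (ksup (Ordinal K0))) ?lee_fin.
  apply: (@le_lt_trans _ _ (\sum_i k i)%:E); last exact: ltry.
  apply: ge_ereal_sup => _ [v [v0 v1] <-]; rewrite lee_fin /wdiv.
  apply: ler_sum => i _; rewrite -kE -[leRHS]mul1r ler_wpM2r// -v1.
  by rewrite (bigD1 i)//= lerDl sumr_ge0.
have {}ksup i : k i <= fine sup by rewrite -lee_fin fineK.
apply: (@le_trans _ _ (\sum_i w i * fine sup)).
  by apply: ler_sum => i _; apply: (ler_wpM2l (w0 i)); exact: ksup.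
by rewrite -mulr_suml ler_wpM2r// (le_trans (k0 (Ordinal K0)) (ksup _)).
Qed.

End complexity_bounds.

(** * The stopping rule and the events of the induction *)

Section stopping.
Context {R : realType} {K : nat} {dS : measure_display}
  {S : measurableType dS} {I : Type}.
Variable alg : batched_algorithm R K S I.
Implicit Types (u : S) (x : nat -> 'I_K -> nat -> R).

Definition first_stop r u x : Prop :=
  stops_at alg u x r /\ forall r', (r' < r)%N -> ~~ stops_at alg u x r'.

(** Unlike the value of [num_batches], this is decided by the first n batches, as [transport]
    requires. *)
Definition running n u x : Prop :=
  forall r, (r <= n)%N -> ~~ stops_at alg u x r.

Lemma final_batch_first r u x :
  final_batch alg u x = Some r <-> first_stop r u x.
Proof.
rewrite /final_batch; case: pselect => [ex|nex]; last first.
  by split=> // -[st _]; exfalso; apply: nex; exists r.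
split=> [[<-]|[st before]].
  case: ex_minnP => m sm mmin; split => // r' r'm.
  by apply/negP => /mmin; rewrite leqNgt r'm.
congr Some; case: ex_minnP => m sm mmin.
apply/eqP; rewrite eqn_leq mmin//= leqNgt.
by apply/negP => /before; rewrite sm.
Qed.

Lemma final_batch_never u x :
  final_batch alg u x = None <-> forall r, ~~ stops_at alg u x r.
Proof.
rewrite /final_batch; case: pselect => [ex|nex]; split => //.
  by move=> H; exfalso; have [r] := ex; rewrite (negbTE (H r)).
by move=> _ r; apply/negP => st; apply: nex; exists r.
Qed.

Lemma running_final_batch n u x : running n u x ->
  if final_batch alg u x is Some r then (n < r)%N else true.
Proof.
move=> run_n; case fb : (final_batch alg u x) => [r|//].
have [st _] := (final_batch_first r u x).1 fb; rewrite ltnNge.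
by apply/negP => /run_n; rewrite st.
Qed.

Lemma num_batches_running n u x :
  (n%:R%:E < num_batches alg u x)%E <-> running n u x.
Proof.
split => [|/running_final_batch]; rewrite /num_batches; last first.
  by case: (final_batch _ _ _) => [r nr|_]; rewrite ?ltry// lte_fin ltr_nat.
case fb : (final_batch _ _ _) => [r|] => [|_ r _].
  rewrite lte_fin ltr_nat => nr r' r'n.
  have [_] := (final_batch_first r u x).1 fb; apply.
  exact: leq_ltn_trans nr.
exact: (final_batch_never u x).1 fb r.
Qed.

(** A run that has not stopped after n batches completes batch n+1, so all samples of that batch
    enter the final count. *)
Lemma running_num_samples n u x (a : R) : running n u x ->
  a < (drawn alg u x n.+1)%:R -> (a%:E < num_samples alg u x)%E.
Proof.
move=> /running_final_batch; rewrite /num_samples.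
case: (final_batch _ _ _) => [r nr|_]; rewrite ?ltry// lte_fin => /lt_le_trans.
by apply; rewrite ler_nat; exact: leq_drawn.
Qed.

Lemma running_prefix n u x x' : run alg u x n = run alg u x' n ->
  running n u x -> running n u x'.
Proof.
move=> xx' run_n r rn; have := run_n r rn.
by rewrite /stops_at (run_prefix rn xx').
Qed.

Lemma runningS n u x : running n u x ->
  ~~ stop alg (u, run alg u x n.+1) -> running n.+1 u x.
Proof.
move=> run_n nst r; rewrite leq_eqVlt => /orP[/eqP ->|]; last exact: run_n.
by rewrite /stops_at (negbTE nst).
Qed.

Lemma running_answer n u x : running n u x ->
  stop alg (u, run alg u x n.+1) ->
  returned_answer alg u x = Some (answer alg (u, run alg u x n.+1)).
Proof.
move=> run_n st; rewrite /returned_answer.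
by have -> : final_batch alg u x = Some n.+1 by exact/final_batch_first.
Qed.

Section measurability.
Context {d : measure_display} {Om : measurableType d}.
Variables (u : Om -> S) (x : nat -> 'I_K -> nat -> Om -> R).
Hypotheses (mu : measurable_fun setT u)
  (mx : forall r i k, measurable_fun setT (x r i k)).
Local Notation samples om := (fun r i k => x r i k om).

Lemma measurable_stops_at r :
  measurable [set om | stops_at alg (u om) (samples om) r].
Proof.
case: r => [|r]; last first.
  exact: (measurable_run_event alg mu mx r.+1 (measurable_stop alg)).
by rewrite (_ : mkset _ = set0)//; apply/seteqP; split.
Qed.

Lemma measurable_not_stops_at (D : set nat) :
  measurable [set om | forall r, D r -> ~~ stops_at alg (u om) (samples om) r].
Proof.
rewrite (_ : mkset _ =
    \bigcap_(r in D) ~` [set om | stops_at alg (u om) (samples om) r]); last first.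
  by apply/seteqP; split => om /= H r Dr; apply/negP; exact: H.
apply: bigcap_measurableType => r _; apply: measurableC.
exact: measurable_stops_at.
Qed.

Lemma measurable_running n : measurable [set om | running n (u om) (samples om)].
Proof. exact: (measurable_not_stops_at [set r | (r <= n)%N]). Qed.

Lemma measurable_first_stop r : measurable [set om | first_stop r (u om) (samples om)].
Proof.
apply: measurableI; first exact: measurable_stops_at.
exact: (measurable_not_stops_at [set r' | (r' < r)%N]).
Qed.

Lemma measurable_drawn_le n c :
  measurable [set om | (drawn alg (u om) (samples om) n <= c)%N].
Proof.
have := measurable_drawn alg mu mx n.
by move=> /(_ measurableT [set k | (k <= c)%N] Logic.I); rewrite setTI.
Qed.

Lemma measurable_num_samples (a : R) :
  measurable [set om | (a%:E < num_samples alg (u om) (samples om))%E].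
Proof.
(* Split along the first stop; [num_samples] is +oo on runs that never stop, and these form a piece
   of the event of their own. *)
rewrite (_ : mkset _ =
  [set om | forall r, setT r -> ~~ stops_at alg (u om) (samples om) r] `|`
  \bigcup_r ([set om | first_stop r (u om) (samples om)] `&`
     [set om | a < (drawn alg (u om) (samples om) r)%:R])).
  apply: measurableU; first exact: measurable_not_stops_at.
  apply: bigcup_measurable => r _; apply: measurableI.
    exact: measurable_first_stop.
  have := measurable_drawn alg mu mx r.
  by move=> /(_ measurableT [set k | a < k%:R] Logic.I); rewrite setTI.
apply/seteqP; split => om /=; rewrite /num_samples.
  case fb : (final_batch _ _ _) => [r|] alt.
    right; exists r => //; split; first exact/final_batch_first.
    by move: alt; rewrite lte_fin.
  by left => r _; exact: ((final_batch_never _ _).1 fb r).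
case=> [never|[r _ [/= /final_batch_first -> //]]].
by rewrite (final_batch_never _ _).2 ?ltry// => r; exact: never.
Qed.

Lemma measurable_wrong_answer (a : I) : measurable
  [set om | exists2 i, returned_answer alg (u om) (samples om) = Some i & i <> a].
Proof.
rewrite (_ : mkset _ =
  \bigcup_r ([set om | first_stop r (u om) (samples om)] `&`
     ~` [set om | answer alg (u om, run alg (u om) (samples om) r) = a])).
  apply: bigcup_measurable => r _; apply: measurableI.
    exact: measurable_first_stop.
  apply: measurableC.
  exact: (measurable_run_event alg mu mx r (measurable_answer alg a)).
apply/seteqP; split => om /=; rewrite /returned_answer.
  case fb : (final_batch _ _ _) => [r|] [i] // [<-] ia.
  by exists r => //; split => //; exact/final_batch_first.
case=> r _ [/= /final_batch_first -> ia].
by exists (answer alg (u om, run alg (u om) (samples om) r)).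
Qed.

Definition frugal n c u x : Prop := running n u x /\ (drawn alg u x n <= c)%N.

Definition frugal_next n c c' u x : Prop :=
  frugal n c u x /\ (drawn alg u x n.+1 <= c')%N.

Definition frugal_answer n c' i u x : Prop :=
  [/\ running n u x, (drawn alg u x n.+1 <= c')%N,
    stop alg (u, run alg u x n.+1) & answer alg (u, run alg u x n.+1) = i].

Lemma measurable_frugal n c : measurable [set om | frugal n c (u om) (samples om)].
Proof.
apply: measurableI; first exact: measurable_running.
exact: measurable_drawn_le.
Qed.

Lemma measurable_frugal_next n c c' :
  measurable [set om | frugal_next n c c' (u om) (samples om)].
Proof.
apply: measurableI; first exact: measurable_frugal.
exact: measurable_drawn_le.
Qed.

Lemma measurable_frugal_answer n c' i :
  measurable [set om | frugal_answer n c' i (u om) (samples om)].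
Proof.
rewrite (_ : mkset _ = [set om | running n (u om) (samples om)] `&`
   ([set om | (drawn alg (u om) (samples om) n.+1 <= c')%N] `&`
   ([set om | stop alg (u om, run alg (u om) (samples om) n.+1)] `&`
    [set om | answer alg (u om, run alg (u om) (samples om) n.+1) = i]))).
  apply: measurableI; first exact: measurable_running.
  apply: measurableI; first exact: measurable_drawn_le.
  apply: measurableI.
    exact: (measurable_run_event alg mu mx n.+1 (measurable_stop alg)).
  exact: (measurable_run_event alg mu mx n.+1 (measurable_answer alg i)).
by apply/seteqP; split => om [] // ? [? []].
Qed.

End measurability.

(** The size of batch n+1 is fixed before any of its samples is seen. Hence the first n batches
    decide this event, although it bounds the total after batch n+1. *)
Lemma frugal_next_prefix n c c' u x x' : run alg u x n = run alg u x' n ->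
  frugal_next n c c' u x -> frugal_next n c c' u x'.
Proof.
move=> xx' [[run_n d1] d2]; split; first split.
- exact: (running_prefix xx').
- by move: d1; rewrite /drawn xx'.
- by move: d2; rewrite !drawnS /batch_size /drawn xx'.
Qed.

Lemma frugal_answer_prefix n c' i u x x' :
  run alg u x n.+1 = run alg u x' n.+1 ->
  frugal_answer n c' i u x -> frugal_answer n c' i u x'.
Proof.
move=> xx' [run_n d1 st an]; split; last 3 first.
- by move: d1; rewrite /drawn xx'.
- by rewrite -xx'.
- by rewrite -xx'.
- exact: (running_prefix (run_prefix (leqnSn n) xx')).
Qed.

End stopping.

Lemma fine_measure_setU (R : realType) d (Om : measurableType d)
    (P : probability Om R) (E F G : set Om) :
  measurable E -> measurable F -> measurable G -> E `<=` F `|` G ->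
  fine (P E) <= fine (P F) + fine (P G).
Proof.
move=> mE mF mG EFG; rewrite -lee_fin EFinD !fineK ?fin_num_measure//.
rewrite (le_trans _ (measureU2 _ _ _))// le_measure ?inE//.
exact: measurableU.
Qed.

Theorem lemma2p1 (R : realType) (K : nat) (hK : (1 <= K)%N)
  (sigma : R) (hsigma : 0 < sigma)
  (* the pure exploration problem *)
  (I : Type) (M : set 'rV[R]_K) (istar : 'rV[R]_K -> I)
  (hnonconst : exists mu lambda,
     [/\ M mu, M lambda & istar mu <> istar lambda])
  (* the probability space on which the algorithm interacts with the arms,
     with one probability measure for each instance *)
  (dS : measure_display) (S : measurableType dS) (nu : probability S R)
  (dW : measure_display) (W : measurableType dW)
  (U : {mfun W >-> S}) (X : nat -> 'I_K -> nat -> {mfun W >-> R})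
  (P : 'rV[R]_K -> probability W R)
  (hP : forall mu, M mu -> gaussian_bandit nu U X sigma mu (P mu))
  (* the algorithm *)
  (delta : R) (hdelta : 0 < delta < 1)
  (alg : batched_algorithm R K S I)
  (hcorrect : forall mu, M mu ->
     (P mu [set om | exists2 i,
              returned_answer alg (U om) (fun r a k => X r a k om) = Some i
              & i <> istar mu] <= delta%:E)%E)
  (Tmin Tmax : \bar R) (hTmin : (0 <= Tmin)%E) (hTmax : (Tmin < Tmax)%E)
  (gamma c : R) (hgamma : 0 < gamma) (hc : 0 < c)
  (hsamples : forall mu, M mu -> (Tmin < Tstar sigma M istar mu < Tmax)%E ->
     (P mu [set om | gamma%:E * Tstar sigma M istar mu * (ln (1 / delta))%:E
              < num_samples alg (U om) (fun r a k => X r a k om)]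
        <= c%:E)%E)
  (* the sequence of instances *)
  (N : nat) (mus : nat -> 'rV[R]_K)
  (hmus : forall n, (n <= N)%N -> M (mus n))
  (zeta : R) (hzeta : 0 < zeta < 1)
  (hTstar : forall n, (n <= N)%N ->
     Tstar sigma M istar (mus n) =
       (Tstar sigma M istar (mus 0%N) * (zeta ^- n)%:E)%E /\
     (Tmin < Tstar sigma M istar (mus n) < Tmax)%E) :
  let S_N : R := \sum_(0 <= n < N)
    (1 + Num.sqrt
       (fine (Tstar sigma M istar (mus 0%N)) / zeta ^+ n *
        fine (ereal_sup [set (wdiv sigma w (mus n.+1) (mus n))%:E
                        | w in simplex]))) in
  ((1 - N%:R * (2 * delta + c)
      - Num.sqrt (gamma * ln (1 / delta) / (2 * (zeta^-1 - 1))) * S_N)%:E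
    <= P (mus N) [set om | N%:R%:E
         < num_batches alg (U om) (fun r a k => X r a k om)])%E.
Proof.
cbv zeta.
have /andP[d0 d1] := hdelta; have /andP[z0 z1] := hzeta.
pose L := ln (1 / delta).
have L0 : 0 < L by rewrite ln_gt0// div1r invf_gt1.
pose T n := fine (Tstar sigma M istar (mus n)).
have TP n : (n <= N)%N -> Tstar sigma M istar (mus n) = (T n)%:E /\ 0 < T n.
  move=> nN; have [_ /andP[lo hi]] := hTstar n nN.
  have Tpos := le_lt_trans hTmin lo.
  have Tfin : Tstar sigma M istar (mus n) \is a fin_num.
    by rewrite ge0_fin_numE ?ltW// (lt_le_trans hi) ?leey.
  by rewrite fineK// -lte_fin fineK.
have TE n : (n <= N)%N -> T n = T 0%N / zeta ^+ n.
  move=> nN; have [TnE _] := hTstar n nN.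
  by move: TnE; rewrite (TP n nN).1 (TP 0%N (leq0n N)).1 -EFinM => -[].
have TS n : (n.+1 <= N)%N -> T n = T n.+1 * zeta.
  move=> nN; rewrite (TE _ (ltnW nN)) (TE _ nN) exprS; field.
  by rewrite expf_neq0 gt_eqF.
pose a := gamma * L; have a0 : 0 < a by rewrite mulr_gt0.
(* For n > 0 the real budget is a T_{n-1}; rounding it down does not affect its comparison with
   counts. *)
pose C n := Num.truncn (a * T n * zeta).
have CE n k : (n <= N)%N -> (k <= C n)%N = (k%:R <= a * T n * zeta).
  move=> nN; rewrite truncn_ge_nat//.
  exact: ltW (mulr_gt0 (mulr_gt0 a0 (TP n nN).2) z0).
have CR n : (n <= N)%N -> (C n)%:R <= a * T n * zeta by move=> nN; rewrite -CE.
pose sup n := fine (ereal_sup [set (wdiv sigma w (mus n.+1) (mus n))%:E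
  | w in simplex]).
pose inc n := 1 + Num.sqrt (T 0%N / zeta ^+ n * sup n).
rewrite -/L -/a (_ : \sum_(0 <= n < N) _ = \sum_(0 <= n < N) inc n)//.
set sq := Num.sqrt _.
(* This is the form met in [step4]: half of the budget a T zeta, times a divergence of 1 / (T (1 -
   zeta)) per sample. *)
have sqE : a / (2 * (zeta^-1 - 1)) = a * zeta / (2 * (1 - zeta)).
  have z1' : 1 - zeta != 0 by rewrite subr_eq0 gt_eqF.
  by field; rewrite z1' gt_eqF.
pose ev (E : S -> (nat -> 'I_K -> nat -> R) -> Prop) : set W :=
  [set om | E (U om) (fun r a k => X r a k om)].
pose p n E := fine (P (mus n) (ev E)).
have mU : measurable_fun setT U by [].
have mX r i k : measurable_fun setT (X r i k) by [].
have M_ n : (n <= N)%N -> M (mus n) := @hmus n.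
pose x n := a * T n * zeta.
(* By [TS] the budget after batch n+1 is a T_n rounded down, so a run exceeding it falls in the
   event that [hsamples] bounds at mu^n. *)
have step1 n : (n < N)%N ->
    p n (frugal alg n (C n)) <= p n (frugal_next alg n (C n) (C n.+1)) + c.
  move=> nN; have nN' := ltnW nN.
  have mslow := @measurable_num_samples _ _ _ _ _ alg _ _ U X mU mX (a * T n).
  apply: (@le_trans _ _ (p n (frugal_next alg n (C n) (C n.+1)) +
    fine (P (mus n) [set om | ((a * T n)%:E <
      num_samples alg (U om) (fun r a k => X r a k om))%E]))).
    apply: fine_measure_setU => //.
    - exact: measurable_frugal.
    - exact: measurable_frugal_next.
    move=> om /= [run_n dn]; have [dn'|dn'] := leqP (drawn alg (U om)
      (fun r a k => X r a k om) n.+1) (C n.+1); [by left|right => /=].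
    apply: (running_num_samples run_n).
    by move: dn'; rewrite ltnNge CE// -ltNge -mulrA -TS.
  rewrite lerD2l -lee_fin fineK ?fin_num_measure//.
  have := hsamples _ (M_ n nN') (hTstar n nN').2.
  by rewrite (TP n nN').1 -/L -!EFinM mulrAC.
(* Only the at most [C n] samples of the first n batches count in this passage from mu^n to
   mu^{n+1}. *)
have step2 n : (n < N)%N ->
    p n (frugal_next alg n (C n) (C n.+1)) <=
    p n.+1 (frugal_next alg n (C n) (C n.+1)) +
      sq * Num.sqrt (T 0%N / zeta ^+ n * sup n).
  move=> nN; have nN' := ltnW nN.
  have [w [w0 wC]] := transport alg n (C n) hsigma (hP _ (M_ n nN')).
  move=> /(_ (mus n.+1) _ (frugal_next alg n (C n) (C n.+1)) (hP _ (M_ n.+1 nN))).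
  move=> /(_ _ _ _)/le_trans; apply.
  - by move=> u y [[]].
  - by move=> u y y'; exact: frugal_next_prefix.
  - by move=> d Om u y mu my; exact: measurable_frugal_next.
  rewrite lerD2l -sqrtrM; last first.
    by rewrite sqE divr_ge0 ?mulr_ge0 ?subr_ge0// ltW.
  rewrite ler_wsqrtr// sqE.
  have wsup := sum_le_sup_wdiv sigma (mus n) (mus n.+1) hK w0
    (le_trans wC (CR n nN')).
  (* Zero weights and the bound 1 on their total turn the lemma into nonnegativity. *)
  have sup0 : 0 <= sup n.
    have := @sum_le_sup_wdiv R K sigma (mus n) (mus n.+1) (fun=> 0) 1 hK.
    by rewrite mul1r !big1// => [|i _]; [apply|rewrite mul0r].
  rewrite -TE//.
  (* The Pinsker bound lacks the factor (1 - zeta)^-1 >= 1, which is put in so that [sq] can be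
     factored out as in [step4]. *)
  have -> : a * zeta / (2 * (1 - zeta)) * (T n * sup n) =
      2^-1 * (a * T n * zeta * sup n) * (1 - zeta)^-1.
    by field; rewrite subr_eq0 gt_eqF.
  apply: (@le_trans _ _ (2^-1 * (a * T n * zeta * sup n))).
    by rewrite ler_wpM2l// invr_ge0.
  have Tn0 := ltW (mulr_gt0 (mulr_gt0 a0 (TP n nN').2) z0).
  apply: ler_peMr; first by rewrite mulr_ge0// mulr_ge0.
  by rewrite invf_ge1 ?subr_gt0// lerBlDr lerDl ltW.
(* After batch n+1 the run continues, stops with a wrong answer, or stops with the right one. *)
have step3 n : (n < N)%N ->
    p n.+1 (frugal_next alg n (C n) (C n.+1)) <=
    p n.+1 (frugal alg n.+1 (C n.+1)) + (delta +
      p n.+1 (frugal_answer alg n (C n.+1) (istar (mus n.+1)))).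
  move=> nN.
  pose wrong : set W := [set om | exists2 i,
    returned_answer alg (U om) (fun r a k => X r a k om) = Some i &
    i <> istar (mus n.+1)].
  have mwrong : measurable wrong by exact: measurable_wrong_answer.
  apply: (@le_trans _ _ (p n.+1 (frugal alg n.+1 (C n.+1)) +
    fine (P (mus n.+1) (wrong `|`
      ev (frugal_answer alg n (C n.+1) (istar (mus n.+1))))))).
    apply: fine_measure_setU.
    - exact: measurable_frugal_next.
    - exact: measurable_frugal.
    - by apply: measurableU => //; exact: measurable_frugal_answer.
    move=> om /= [[run_n dn] dn'].
    have [st|nst] := boolP (stop alg (U om,
      run alg (U om) (fun r a k => X r a k om) n.+1)); last first.
      by left; split => //; exact: runningS.
    right; have [an|an] := pselect (answer alg (U om,
      run alg (U om) (fun r a k => X r a k om) n.+1) = istar (mus n.+1)).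
      by right; split.
    left; exists (answer alg (U om,
      run alg (U om) (fun r a k => X r a k om) n.+1)) => //.
    exact: running_answer.
  rewrite lerD2l; apply: (@le_trans _ _ (fine (P (mus n.+1) wrong) +
      p n.+1 (frugal_answer alg n (C n.+1) (istar (mus n.+1))))).
    apply: fine_measure_setU => //; last exact: measurable_frugal_answer.
    by apply: measurableU => //; exact: measurable_frugal_answer.
  rewrite lerD2r -lee_fin fineK ?fin_num_measure//.
  exact: hcorrect _ (M_ n.+1 nN).
(* The right answer for mu^{n+1} is wrong for [lam], where it has probability at most delta. The
   choice of [lam] follows that of [w], the sampling effort under mu^{n+1}. *)
have step4 n : (n < N)%N ->
    p n.+1 (frugal_answer alg n (C n.+1) (istar (mus n.+1))) <= delta + sq.
  move=> nN; have [T1 T1pos] := TP n.+1 nN.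
  have [w [w0 wC trans]] := transport alg n.+1 (C n.+1) hsigma (hP _ (M_ n.+1 nN)).
  have [lam [Mlam ilam] wlam] := exists_confusing_instance hK T1 T1pos hzeta w0
    (le_trans wC (CR n.+1 nN)).
  move: trans => /(_ lam _ (frugal_answer alg n (C n.+1) (istar (mus n.+1)))
    (hP _ Mlam)).
  move=> /(_ _ _ _)/le_trans; apply.
  - by move=> u y [].
  - by move=> u y y'; exact: frugal_answer_prefix.
  - by move=> d Om u y mu my; exact: measurable_frugal_answer.
  apply: lerD; last first.
    rewrite ler_wsqrtr// sqE.
    apply: (@le_trans _ _ (2^-1 * (a * T n.+1 * zeta / (T n.+1 * (1 - zeta))))).
      by rewrite ler_wpM2l// invr_ge0.
    have z1' : 1 - zeta != 0 by rewrite subr_eq0 gt_eqF.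
    by rewrite le_eqVlt; apply/orP; left; apply/eqP; field; rewrite z1' gt_eqF.
  have mwrong := measurable_wrong_answer alg mU mX (istar lam).
  rewrite -lee_fin (le_trans _ (hcorrect _ Mlam))//.
  rewrite fineK; last by apply: fin_num_measure; exact: measurable_frugal_answer.
  apply: le_measure; rewrite ?inE//; first exact: measurable_frugal_answer.
  move=> om /= [run_n _ st an].
  by exists (istar (mus n.+1)); [rewrite (running_answer run_n st) an|exact: nesym].
(* One batch costs c in [step1], delta in [step3], delta + sq in [step4], and sq times a square root
   in [step2]; the summand 1 in [inc] accounts for the sq of [step4]. *)
have main n : (n <= N)%N ->
    1 - n%:R * (2 * delta + c) - sq * (\sum_(0 <= k < n) inc k) <=
    p n (frugal alg n (C n)).
  elim: n => [_|n IH nN].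
    (* Before the first batch nothing is drawn and no stop is possible, so the event is the whole
       space. *)
    rewrite mul0r big_geq// mulr0 !subr0 /p.
    rewrite (_ : ev _ = setT) ?probability_setT//.
    apply/seteqP; split => // om _; split; last by rewrite drawn0.
    by move=> r; rewrite leqn0 => /eqP ->.
  have := IH (ltnW nN); have := step1 n nN; have := step2 n nN.
  have := step3 n nN; have := step4 n nN.
  have -> : sq * (\sum_(0 <= k < n.+1) inc k) = sq * (\sum_(0 <= k < n) inc k) +
      (sq + sq * Num.sqrt (T 0%N / zeta ^+ n * sup n)).
    by rewrite big_nat_recr//= mulrDr /inc mulrDr mulr1.
  rewrite -natr1 => h4 h3 h2 h1 h0; clear -h4 h3 h2 h1 h0.
  by lra.
have -> : [set om | (N%:R%:E < num_batches alg (U om)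
    (fun r a k => X r a k om))%E] = ev (running alg N).
  by apply/seteqP; split => om /num_batches_running.
apply: (@le_trans _ _ (p N (frugal alg N (C N)))%:E).
  by rewrite lee_fin main.
rewrite fineK; last by apply: fin_num_measure; exact: measurable_frugal.
apply: le_measure; rewrite ?inE//.
- exact: measurable_frugal.
- exact: measurable_running.
- by move=> om [].
Qed.
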